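(* Let $m,n\ge1$, let $g_{12}$ be an arbitrary complex $2m\times 2n$ matrix (or, equivalently, $g_{21}$ an arbitrary $2n\times 2m$ matrix), related by $g_{21}=-U_{2n}J_{2n}g_{12}^{\tau}J_{2m}U_{2m}$, and let $G,\theta,\widehat u,u,\omega$ be as in the context. Then $\omega$ determines a unique complex $mn\times mn$ matrix $R$ such that $$\omega(\lambda,\mu)=\mathbf 1^*(A_1^*-\mu_1I)^{-1}(A_2^*-\mu_2I)^{-1}R(A_2-\lambda_2I)^{-1}(A_1-\lambda_1I)^{-1}\mathbf 1 .$$ If moreover $\det R\neq0$, then $T=R^{-1}$ is a Toeplitz-block Toeplitz matrix, i.e. $T=\{\mathcal T_{i-k}\}_{i,k=1}^n$ with $m\times m$ blocks of the form $\mathcal T_r=\{t_r^{(j-\ell)}\}_{j,\ell=1}^m$.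
   Context: $\mathrm{i}$ is the imaginary unit, $I_r$ the $r\times r$ identity, $I=I_{mn}$, $\mathbf 1_r$ the all-ones column of length $r$, $\mathbf 1=\mathbf 1_{mn}$, $^*$ conjugate transpose, $^\tau$ transpose. For $N\ge1$, $\mathcal{A}^{(N)}=\{a_{j-\ell}\}_{j,\ell=1}^N$ with $a_r=0$ ($r<0$), $a_0=\mathrm{i}/2$, $a_r=\mathrm{i}$ ($r>0$); $\mathcal A_1=\mathcal A^{(n)}$, $\mathcal A_2=\mathcal A^{(m)}$, $A_1=\{a_{i-k}I_m\}_{i,k=1}^n$, $A_2=\mathrm{diag}\{\mathcal A_2,\dots,\mathcal A_2\}$ ($n$ blocks). $U_{2N}$ is the $2N\times2N$ antidiagonal matrix of ones; $J_{2N}=\mathrm{diag}\{I_N,-I_N\}$; $P_1=\mathrm{diag}\{I_{2m},0_{2n}\}$, $P_2=I_{2(m+n)}-P_1$. $G(\lambda)=\begin{bmatrix}\mathrm{diag}\{\mathcal A_2-\lambda_2I_m,\mathcal A_2-\lambda_2I_m\}&g_{12}\\ g_{21}&\mathrm{diag}\{\mathcal A_1-\lambda_1I_n,\mathcal A_1-\lambda_1I_n\}\end{bmatrix}$; $\theta(\lambda)$ is the polynomial with $\theta^2=\det G$ whose coefficient of $\lambda_1^n\lambda_2^m$ is $-1$; $\widehat u(\lambda)=-\mathrm{i}(\lambda_1-\frac{\mathrm{i}}2)^{-n}(\lambda_2-\frac{\mathrm{i}}2)^{-m}\theta(\lambda)G(\lambda)^{-1}\mathrm{col}[0,\mathbf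 1_m,0,\mathbf 1_n]$ (zero blocks of heights $m,n$); $u(\mu)=\big(\frac{\mu_1-\mathrm{i}/2}{\mu_1+\mathrm{i}/2}\big)^n\big(\frac{\mu_2-\mathrm{i}/2}{\mu_2+\mathrm{i}/2}\big)^m\widehat u(\mu)^{\tau}\mathrm{diag}\{J_{2m}U_{2m},J_{2n}U_{2n}\}$; $\omega(\lambda,\mu)=\mathrm{i}(\lambda_1-\mu_1)^{-1}u(\mu)P_1\widehat u(\lambda)$ (which coincides with $\mathrm{i}(\lambda_2-\mu_2)^{-1}u(\mu)P_2\widehat u(\lambda)$). *)

(* Defs.v *)
From mathcomp Require Import all_boot all_order all_algebra.
Set Implicit Arguments. Unset Strict Implicit. Unset Printing Implicit Defensive.
Import Order.TTheory GRing.Theory Num.Theory.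
Local Open Scope ring_scope.

(* The complex field is modelled by an arbitrary numClosedFieldType C
   (algebraically closed char-0 field with conjugation), e.g. C = R[i]. *)

Section Defs.
Variable C : numClosedFieldType.

Definition acoef (r : int) : C :=
  if (r < 0)%R then 0 else if r == 0 then 'i / 2%:R else 'i.

Definition calA (N : nat) : 'M[C]_N :=
  \matrix_(j < N, l < N) acoef (j%:Z - l%:Z).

(* indices of C^{mn}: k <-> (block k %/ m, inner k %% m) *)
(* A_1 = {a_{i-k} I_m}_{i,k=1}^n *)
Definition A1 (m n : nat) : 'M[C]_(m * n) :=
  \matrix_(k < m * n, k' < m * n)
    (acoef ((k %/ m)%N%:Z - (k' %/ m)%N%:Z) * (((k %% m)%N == (k' %% m)%N)%:R)).

(* A_2 = diag{calA m, ..., calA m} (n blocks) *)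
Definition A2 (m n : nat) : 'M[C]_(m * n) :=
  \matrix_(k < m * n, k' < m * n)
    ((((k %/ m)%N == (k' %/ m)%N)%:R) * acoef ((k %% m)%N%:Z - (k' %% m)%N%:Z)).

Definition Umx (N : nat) : 'M[C]_(N + N) :=
  \matrix_(i < N + N, j < N + N) ((i + j == (N + N).-1)%N%:R).
Definition Jmx (N : nat) : 'M[C]_(N + N) := block_mx 1 0 0 (- 1).

Definition ctr (p q : nat) (M : 'M[C]_(p, q)) : 'M[C]_(q, p) := map_mx Num.conj M^T.

Definition Gmx (m n : nat) (g12 : 'M[C]_(m + m, n + n)) (g21 : 'M[C]_(n + n, m + m))
  (l1 l2 : C) : 'M[C]_((m + m) + (n + n)) :=
  block_mx (block_mx (calA m - l2%:M) 0 0 (calA m - l2%:M)) g12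
           g21 (block_mx (calA n - l1%:M) 0 0 (calA n - l1%:M)).

(* bivariate polynomial: outer variable lambda_1, inner variable lambda_2 *)
Definition peval2 (p : {poly {poly C}}) (l1 l2 : C) : C :=
  (map_poly (fun q : {poly C} => q.[l2]) p).[l1].

Definition pcoef2 (p : {poly {poly C}}) (i j : nat) : C := (p`_i)`_j.

Definition rhsvec (m n : nat) : 'cV[C]_((m + m) + (n + n)) :=
  col_mx (col_mx 0 (const_mx 1)) (col_mx 0 (const_mx 1)).

Definition uhat (m n : nat) g12 g21 (theta : {poly {poly C}}) (l1 l2 : C)
  : 'cV[C]_((m + m) + (n + n)) :=
  (- 'i * (l1 - 'i / 2%:R) ^- n * (l2 - 'i / 2%:R) ^- m * peval2 theta l1 l2)
    *: (invmx (@Gmx m n g12 g21 l1 l2) *m rhsvec m n).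

Definition ufun (m n : nat) g12 g21 theta (m1 m2 : C) : 'rV[C]_((m + m) + (n + n)) :=
  (((m1 - 'i / 2%:R) / (m1 + 'i / 2%:R)) ^+ n * ((m2 - 'i / 2%:R) / (m2 + 'i / 2%:R)) ^+ m)
    *: ((@uhat m n g12 g21 theta m1 m2)^T *m block_mx (Jmx m *m Umx m) 0 0 (Jmx n *m Umx n)).

Definition P1 (m n : nat) : 'M[C]_((m + m) + (n + n)) := block_mx 1 0 0 0.

Definition omega (m n : nat) g12 g21 theta (l1 l2 m1 m2 : C) : C :=
  'i * (l1 - m1)^-1 *
  (@ufun m n g12 g21 theta m1 m2 *m P1 m n *m @uhat m n g12 g21 theta l1 l2) 0 0.

Definition omega_rhs (m n : nat) (R : 'M[C]_(m * n)) (l1 l2 m1 m2 : C) : C :=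
  (const_mx 1 *m invmx (ctr (A1 m n) - m1%:M) *m invmx (ctr (A2 m n) - m2%:M)
    *m R *m invmx (A2 m n - l2%:M) *m invmx (A1 m n - l1%:M) *m const_mx 1
    : 'M[C]_1) 0 0.

Definition toeplitz_block_toeplitz (m n : nat) (T : 'M[C]_(m * n)) : Prop :=
  exists t : int -> int -> C, forall k k' : 'I_(m * n),
    T k k' = t ((k %/ m)%N%:Z - (k' %/ m)%N%:Z) ((k %% m)%N%:Z - (k' %% m)%N%:Z).

End Defs.

(* Main.v *)
Require Import Defs.
From HB Require Import structures.
From mathcomp Require Import all_boot all_order all_algebra.
From mathcomp Require Import polyXY.
From mathcomp Require Import ring zify.
Import Order.TTheory GRing.Theory Num.Theory.
Local Open Scope ring_scope.

Set Implicit Arguments.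
Unset Strict Implicit.
Unset Printing Implicit Defensive.

(** With S = diag(JU, -JU) the matrix S G(lambda) is skew-symmetric, so that
    (theta x^T S G^-1 r)^2 is a bordered determinant; by integral closedness
    Q = theta G^-1 r is a polynomial vector, of bidegree at most (n, m-1) in its
    first block and (n-1, m) in its second.  Skew-symmetry also gives
    (l2 - m2) Q1(mu)^T JU Q1(lambda) = (l1 - m1) Q2(mu)^T JU Q2(lambda).

    In the variables z = (l + i/2)/(l - i/2) and w = (m - i/2)/(m + i/2) the
    resolvent vectors of the statement are vectors of monomials, and, up to the
    same scalar factors, omega is N1(w,z)/(1 - w1 z1) = N2(w,z)/(1 - w2 z2),
    where N1 (resp. N2) is a sum of 2m (resp. 2n) products p(w) q(z).  As N1
    vanishes on w1 z1 = 1, the quotient is a polynomial, whose coefficients form R.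

    Thus the outer displacement of R (R minus its translate by one block, in
    size m(n+1)) has rank at most 2m, so its kernel has dimension at least
    m(n-1).  A kernel vector v satisfies R v' = (0, y) and R v'' = (y, 0), where
    v' and v'' drop the last and the first block of v; a dimension count makes
    every y occur, and comparing v' = T (0, y) and v'' = T (y, 0) on their common
    blocks shows that T is invariant under the outer shift.  The inner shift is
    treated with N2 after exchanging the two levels of blocks. *)

(** * Skew-symmetry and the polynomial vector theta G^-1 r *)

Section Symmetry.
Variable C : numClosedFieldType.

Definition rev_mx N : 'M[C]_N := \matrix_(i, j) (j == rev_ord i)%:R.

Lemma mul_rev_mx N p (M : 'M[C]_(N, p)) i j : (rev_mx N *m M) i j = M (rev_ord i) j.
Proof.
rewrite mxE (bigD1 (rev_ord i)) //= mxE eqxx mul1r big1 ?addr0 // => k.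
by rewrite mxE => /negPf ->; rewrite mul0r.
Qed.

Lemma mulmx_rev N p (M : 'M[C]_(p, N)) i j : (M *m rev_mx N) i j = M i (rev_ord j).
Proof.
rewrite mxE (bigD1 (rev_ord j)) //= mxE rev_ordK eqxx mulr1 big1 ?addr0 // => k.
by rewrite mxE eq_sym (inv_eq rev_ordK) => /negPf ->; rewrite mulr0.
Qed.

Lemma rev_mxK N : rev_mx N *m rev_mx N = 1%:M.
Proof. by apply/matrixP=> i j; rewrite mul_rev_mx !mxE rev_ordK eq_sym. Qed.

Lemma tr_rev_mx N : (rev_mx N)^T = rev_mx N.
Proof. by apply/matrixP=> i j; rewrite !mxE eq_sym (inv_eq rev_ordK). Qed.

Lemma Umx_block N : Umx C N = block_mx 0 (rev_mx N) (rev_mx N) 0.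
Proof.
apply/matrixP=> i j; rewrite -[i]splitK -[j]splitK mxE.
case: (split i) => {}i; case: (split j) => {}j /=.
- rewrite block_mxEul mxE (_ : (_ == _) = false) //; apply/negbTE.
  have := ltn_ord i; have := ltn_ord j; lia.
- rewrite block_mxEur mxE; congr (_ %:R); rewrite -val_eqE /=; have := ltn_ord i; lia.
- rewrite block_mxEdl mxE; congr (_ %:R); rewrite -val_eqE /=; have := ltn_ord i; lia.
- rewrite block_mxEdr mxE (_ : (_ == _) = false) //; apply/negbTE; have := ltn_ord i; lia.
Qed.

Definition sym_mx N : 'M[C]_(N + N) := block_mx 0 (rev_mx N) (- rev_mx N) 0.

Lemma Jmx_mul_Umx N : Jmx C N *m Umx C N = sym_mx N.
Proof.
by rewrite Umx_block /Jmx mulmx_block !(mul0mx, mulmx0, mul1mx, mulNmx) !addr0 !add0r.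
Qed.

Lemma Umx_mul_Jmx N : Umx C N *m Jmx C N = - sym_mx N.
Proof.
rewrite Umx_block /Jmx mulmx_block !(mul0mx, mulmx0, mulmx1, mulmxN) !addr0 !add0r.
by rewrite opp_block_mx !(oppr0, opprK).
Qed.

Lemma tr_sym_mx N : (sym_mx N)^T = - sym_mx N.
Proof. by rewrite tr_block_mx opp_block_mx !linearN /= tr_rev_mx trmx0 !oppr0 !opprK. Qed.

Lemma sym_mxK N : sym_mx N *m sym_mx N = - 1%:M.
Proof.
rewrite mulmx_block !(mul0mx, mulmx0, mulNmx, mulmxN, rev_mxK) !addr0 !add0r.
by rewrite (@scalar_mx_block _ N N) opp_block_mx !oppr0.
Qed.

(** The hypothesis is persymmetry, which Toeplitz matrices have; it gives
    [X^T *m rev_mx N = rev_mx N *m X], as needed in the off-diagonal blocks. *)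
Lemma sym_mx_toeplitz N (X : 'M[C]_N) : X^T = rev_mx N *m X *m rev_mx N ->
  sym_mx N *m block_mx X 0 0 X = (block_mx X 0 0 X)^T *m sym_mx N.
Proof.
move=> XT; rewrite tr_block_mx !mulmx_block !trmx0 XT.
rewrite !(mul0mx, mulmx0, mulNmx, mulmxN) !addr0 !add0r.
by rewrite -!mulmxA rev_mxK !mulmx1.
Qed.

Lemma calA_shift_toeplitz N (l : C) :
  (calA C N - l%:M)^T = rev_mx N *m (calA C N - l%:M) *m rev_mx N.
Proof.
apply/matrixP=> i j; rewrite mulmx_rev mul_rev_mx !mxE (inj_eq rev_ord_inj).
congr (acoef _ _ - l *+ _); last by rewrite eq_sym.
have := ltn_ord i; have := ltn_ord j; rewrite /=; lia.
Qed.

Variables (m n : nat) (g12 : 'M[C]_(m + m, n + n)) (g21 : 'M[C]_(n + n, m + m)).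
Hypothesis g21E : g21 = - (Umx C n *m Jmx C n *m g12^T *m Jmx C m *m Umx C m).

(* diag(J_{2m}U_{2m}, -J_{2n}U_{2n}): the sign makes Smx G(lambda) skew-symmetric. *)
Definition Smx : 'M[C]_((m + m) + (n + n)) := block_mx (sym_mx m) 0 0 (- sym_mx n).

Lemma tr_Smx : Smx^T = - Smx.
Proof.
rewrite /Smx tr_block_mx (opp_block_mx (sym_mx m)) !trmx0 !oppr0 (raddfN trmx) /= !tr_sym_mx.
by rewrite ?opprK.
Qed.

Lemma SmxK : Smx *m Smx = - 1%:M.
Proof.
rewrite mulmx_block !(mul0mx, mulmx0, mulNmx, mulmxN, sym_mxK) !addr0 !add0r.
by rewrite opprK (@scalar_mx_block _ (m + m) (n + n)) opp_block_mx !oppr0.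
Qed.

(** As [Smx] is skew-symmetric, this makes S G skew-symmetric. The diagonal blocks use the
    persymmetry of the shifted [calA], the others the relation between [g21] and [g12]. *)
Lemma Smx_Gmx l1 l2 : Smx *m Gmx g12 g21 l1 l2 = (Gmx g12 g21 l1 l2)^T *m Smx.
Proof.
rewrite /Gmx /Smx tr_block_mx [LHS]mulmx_block [RHS]mulmx_block.
rewrite !(mul0mx, mulmx0) !addr0 !add0r !(mulNmx (sym_mx n)) !(mulmxN _ (sym_mx n)).
have -> : g21 = sym_mx n *m g12^T *m sym_mx m.
  by rewrite g21E Umx_mul_Jmx -mulmxA Jmx_mul_Umx !mulNmx opprK.
rewrite !trmx_mul trmxK !tr_sym_mx !(mulNmx (sym_mx _)) !mulmxN.
rewrite !sym_mx_toeplitz; try exact: calA_shift_toeplitz.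
congr block_mx.
  by rewrite opprK -!mulmxA sym_mxK !mulmxN mulmx1 opprK.
by rewrite !mulmxA sym_mxK !mulNmx mul1mx opprK.
Qed.

End Symmetry.

(** * Bivariate polynomials: vanishing, degrees, integral closedness *)

Section Polynomials.

(** Each term of the Leibniz formula takes one entry from every row, so row-wise degree bounds add
    up. *)
Lemma size_det_leq (R : idomainType) N (M : 'M[{poly R}]_N) (d : 'I_N -> nat) :
  (forall i j, (size (M i j) <= (d i).+1)%N) -> (size (\det M) <= (\sum_i d i).+1)%N.
Proof.
move=> szM; rewrite /determinant; apply: (leq_trans (size_sum _ _ _)).
apply/bigmax_leqP => s _; rewrite -(rmorph_sign (polyC (R := R))) mul_polyC.
apply: (leq_trans (size_scale_leq _ _)).
apply: (leq_trans (size_poly_prod_leq _ _)); rewrite leq_subLR.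
have -> : #|[pred _ : 'I_N | true]| = (\sum_(i < N) 1)%N by rewrite sum1_card.
by rewrite addnS ltnS -big_split leq_sum.
Qed.

(** Stated over a domain so that it also serves with coefficients in [{poly C}], where [f]
    enumerates constants. *)
Lemma poly_eq0_inj (R : idomainType) (f : nat -> R) (p : {poly R}) :
  injective f -> (forall i, p.[f i] = 0) -> p = 0.
Proof.
move=> f_inj pf0; apply/eqP; apply: contraT => nz_p.
have : (size [seq f i | i <- iota 0 (size p)] < size p)%N.
  apply: max_poly_roots => //; last by rewrite map_inj_uniq ?iota_uniq.
  by apply/allP=> _ /mapP[i _ ->]; rewrite rootE pf0.
by rewrite size_map size_iota ltnn.
Qed.

Variable C : numClosedFieldType.

Lemma natr_inj : injective (fun i : nat => i%:R : C).
Proof. by move=> i j /eqP; rewrite eqr_nat => /eqP. Qed.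

Lemma poly_eq0 (p : {poly C}) : (forall x, p.[x] = 0) -> p = 0.
Proof. by move=> p0; apply: poly_eq0_inj natr_inj _. Qed.

Lemma bipoly_eq0 (p : {poly {poly C}}) : (forall x y, p.[x, y] = 0) -> p = 0.
Proof.
move=> p0; apply: (@poly_eq0_inj _ (fun i => (i%:R)%:P)) => [i j /polyC_inj/natr_inj//|i].
by apply: poly_eq0.
Qed.

Lemma bipoly_eq0_generic (d p : {poly {poly C}}) :
  d != 0 -> (forall x y, d.[x, y] != 0 -> p.[x, y] = 0) -> p = 0.
Proof.
move=> nz_d p0; have: d * p = 0.
  apply: bipoly_eq0 => x y; rewrite !hornerM; have [->|/p0->] := eqVneq d.[x, y] 0.
    by rewrite mul0r.
  by rewrite mulr0.
by move/eqP; rewrite mulf_eq0 (negPf nz_d) => /eqP.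
Qed.

(* A root of the content c is a root of all coefficients of q, hence can be
   cancelled from both. *)
Lemma bipoly_content_sqr (c : {poly C}) (q b : {poly {poly C}}) :
  c != 0 -> q ^+ 2 = c%:P ^+ 2 * b -> exists q', q = c%:P * q'.
Proof.
have [k] := ubnP (size c); elim: k => // k IHk in c q *.
rewrite ltnS => le_ck nz_c Eq; have [sz1|sz_c] := eqVneq (size c) 1%N.
  have /size_poly1P[a nz_a ->] : size c == 1%N by rewrite sz1.
  exists (a^-1%:P%:P * q).
  by rewrite mulrA -!rmorphM /= mulfV // mul1r.
have [x c_x] := closed_rootP c sz_c.
have [c' Dc] := factor_theorem _ _ c_x.
have nz_c' : c' != 0 by apply: contraNneq nz_c => c'0; rewrite Dc c'0 mul0r.
have q_x0 : map_poly (horner_eval x) q = 0.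
  apply/eqP; rewrite -sqrf_eq0 -rmorphXn Eq rmorphM rmorphXn /=.
  by rewrite map_polyC /= /horner_eval (rootP c_x) rmorph0 expr0n mul0r.
have [q1 Dq] : exists q1, q = ('X - x%:P)%:P * q1.
  exists (map_poly (fun u : {poly C} => u %/ ('X - x%:P)) q).
  apply/polyP=> i; rewrite coefCM coef_map_id0 ?div0p // mulrC divpK //.
  rewrite dvdp_XsubCl; apply/rootP.
  by move/polyP/(_ i): q_x0; rewrite coef_map coef0.
have nz_x : ('X - x%:P)%:P != 0 :> {poly {poly C}} by rewrite polyC_eq0 polyXsubC_eq0.
have [||q' Dq'] := IHk c' q1 _ nz_c'.
- by move: le_ck; rewrite Dc size_Mmonic ?monicXsubC // size_XsubC addn2.
- apply: (mulfI (expf_neq0 2 nz_x)); rewrite -exprMn -Dq Eq Dc rmorphM /=; ring.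
by exists q'; rewrite Dq Dq' Dc rmorphM /=; ring.
Qed.

(* C[y][x] is integrally closed: pseudo-division in x leaves a denominator c in
   C[y], which [bipoly_content_sqr] removes. *)
Lemma bipoly_sqr_dvd (t a b : {poly {poly C}}) :
  t != 0 -> a ^+ 2 = t ^+ 2 * b -> exists2 q, a = t * q & q ^+ 2 = b.
Proof.
(* Over [{poly C}] the relation [%|] is divisibility up to a nonzero factor in C[y], and it passes
   from squares to their bases. *)
move=> nz_t Ea; have t_dv_a : (t %| a)%R.
  rewrite -(@dvdp_pexp2r _ _ _ 2%N) // Ea.
  exact: dvdp_mulIl.
set k := scalp a t; set c := lead_coef t ^+ k; set u := a %/ t.
have Eu : c *: a = u * t by apply/eqP; rewrite -Pdiv.WeakIdomain.dvdp_eq.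
have nz_c : c != 0 by rewrite expf_neq0 ?lead_coef_eq0.
have nz_t2 := expf_neq0 2 nz_t.
have [q Dq] : exists q, u = c%:P * q.
  apply: (bipoly_content_sqr (b := b)) nz_c _.
  apply: (mulfI nz_t2); rewrite -exprMn [t * u]mulrC -Eu -mul_polyC exprMn Ea.
  by ring.
have nz_cP : c%:P != 0 :> {poly {poly C}} by rewrite polyC_eq0.
have Dt : a = t * q.
  by apply: (mulfI nz_cP); rewrite mul_polyC Eu Dq; ring.
by exists q => //; apply: (mulfI nz_t2); rewrite -Ea Dt exprMn.
Qed.

End Polynomials.

(** * Bordered determinants and skew-symmetry *)

Section Bordered.
Variables (F : numFieldType) (N : nat).

Lemma det_skew2 (Z : 'M[F]_(1 + 1)) : Z^T = - Z -> \det Z = Z 0 1 ^+ 2.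
Proof.
move=> skewZ; have Zskew i j : Z i j = - Z j i.
  by have /matrixP/(_ j i) := skewZ; rewrite !mxE.
have Zdiag i : Z i i = 0.
  have /eqP := Zskew i i; rewrite -subr_eq0 opprK -mulr2n -mulr_natl mulf_eq0.
  by rewrite pnatr_eq0 => /eqP.
rewrite (expand_det_row _ 0) !big_ord_recl big_ord0 Zdiag mul0r add0r addr0.
rewrite /cofactor /row' /col' det_mx11 !mxE expr1.
rewrite (_ : lift _ _ = 1); last exact/val_inj.
rewrite (_ : lift _ _ = 0); last exact/val_inj.
rewrite [Z 1 0]Zskew /=; ring.
Qed.

(* S G^-1 is skew-symmetric, so the Schur complement of G is a skew 2 x 2 matrix
   whose determinant is the square of its entry x^T S G^-1 r. *)
Lemma det_bordered (S G : 'M[F]_N) (x r : 'cV[F]_N) :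
    S^T = - S -> S *m G = G^T *m S -> G \in unitmx ->
  \det (block_mx G (row_mx x r) ((row_mx x r)^T *m S) 0)
    = \det G * ((x^T *m S *m (invmx G *m r)) 0 0) ^+ 2.
Proof.
move=> skewS symSG uG; set w := row_mx x r; set v := w^T *m S.
have /(congr1 determinant) : block_mx G w v 0 *m block_mx 1%:M (- (invmx G *m w)) 0 1%:M
    = block_mx G 0 v (- (v *m invmx G *m w)).
  by rewrite mulmx_block !(mulmx1, mulmx0, mulmxN, addr0, mul0mx) mulmxA mulmxV //
     mul1mx addNr mulmxA.
rewrite det_mulmx det_ublock !det1 !mulr1 det_lblock => ->; congr (_ * _).
have skewH : (S *m invmx G)^T = - (S *m invmx G).
  rewrite trmx_mul skewS mulmxN trmx_inv; congr (- _).
  apply: (can_inj (mulKmx (_ : G^T \in unitmx))); first by rewrite unitmx_tr.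
  by rewrite mulKVmx ?unitmx_tr // mulmxA -symSG -mulmxA mulmxV ?mulmx1.
have -> : v *m invmx G *m w = w^T *m (S *m invmx G) *m w by rewrite mulmxA.
rewrite det_skew2; last first.
  by rewrite linearN /= trmx_mul [(w^T *m _)^T]trmx_mul skewH trmxK mulNmx mulmxN mulmxA.
have E0 : 0 = lshift 1 0 :> 'I_(1 + 1) by apply: val_inj.
have E1 : 1 = rshift 1 0 :> 'I_(1 + 1) by apply: val_inj.
by rewrite [in LHS]mxE sqrrN tr_row_mx mul_col_mx mul_col_row E0 E1 block_mxEur !mulmxA.
Qed.

End Bordered.

(** * The polynomial solution of G Q = theta r and its bidegree *)

Section PolynomialSolution.
Variable C : numClosedFieldType.

(** Made a ring morphism, like [bieval], so that it commutes with products, adjugates and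
    determinants through [map_mx]. *)
Definition const2 (c : C) : {poly {poly C}} := c%:P%:P.

HB.instance Definition _ := GRing.RMorphism.copy const2 (polyC \o polyC).

Definition bieval (l1 l2 : C) (p : {poly {poly C}}) : C := p.[l1, l2].

HB.instance Definition _ l1 l2 :=
  GRing.RMorphism.copy (bieval l1 l2) (horner_eval l2 \o horner_eval l1%:P).

Lemma bieval_const2 l1 l2 c : bieval l1 l2 (const2 c) = c.
Proof. by rewrite /bieval /const2 !hornerC. Qed.

Lemma swapXY_const2 c : swapXY (const2 c) = const2 c.
Proof. by rewrite /const2 swapXY_polyC map_polyC. Qed.

Lemma map_bieval_const2 l1 l2 p q (A : 'M[C]_(p, q)) :
  map_mx (bieval l1 l2) (map_mx const2 A) = A.
Proof. by apply/matrixP=> i j; rewrite !mxE bieval_const2. Qed.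

(** [peval2] specialises the inner variable first, [bieval] the outer one. *)
Lemma peval2E p l1 l2 : peval2 p l1 l2 = bieval l1 l2 p :> C.
Proof. by rewrite /peval2 -(horner_swapXY p) horner2_swapXY. Qed.

Lemma size_const2 c : (size (const2 c) <= 1)%N.
Proof. exact: size_polyC_leq1. Qed.

Lemma size_map_const2_mul p q N (A : 'M[C]_(p, q)) (V : 'cV[{poly {poly C}}]_q) i :
    (forall k, (size (V k 0%R) <= N)%N) ->
  (size ((map_mx const2 A *m V) i 0%R) <= N)%N.
Proof.
move=> szV; rewrite mxE; apply: (leq_trans (size_sum _ _ _)).
apply/bigmax_leqP=> k _; rewrite mxE mul_polyC.
exact: leq_trans (size_scale_leq _ _) (szV k).
Qed.

Variables (m n : nat) (g12 : 'M[C]_(m + m, n + n)) (g21 : 'M[C]_(n + n, m + m)).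
Local Notation G := (Gmx g12 g21).

(** The variables are parameters: [Gpoly 'Y 'X] is the image of [Gpoly 'X 'Y] under the exchange of
    variables, so one degree bound serves for both variables. *)
Definition Gpoly (x y : {poly {poly C}}) :=
  map_mx const2 (G 0 0) - block_mx (y%:M) 0 0 (x%:M).

Lemma GmxE l1 l2 : G l1 l2 = G 0 0 - block_mx (l2%:M) 0 0 (l1%:M).
Proof.
have scal N (X : 'M[C]_N) (l : C) :
    block_mx (X - l%:M) 0 0 (X - l%:M) = block_mx X 0 0 X - l%:M :> 'M[C]_(N + N).
  by rewrite (@scalar_mx_block _ N N) opp_block_mx add_block_mx !oppr0 !addr0.
rewrite /Gmx !scal !(raddf0 (@scalar_mx C _)) !subr0.
by rewrite opp_block_mx add_block_mx !oppr0 !addr0.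
Qed.

Lemma map_Gpoly (f : {rmorphism {poly {poly C}} -> {poly {poly C}}}) x y :
  (forall c, f (const2 c) = const2 c) -> map_mx f (Gpoly x y) = Gpoly (f x) (f y).
Proof.
move=> f_const; rewrite /Gpoly map_mxB (map_block_mx f y%:M) !map_scalar_mx !map_mx0.
by congr (_ - _); rewrite -map_mx_comp; apply: eq_map_mx => c /=.
Qed.

Lemma bieval_Gpoly l1 l2 : map_mx (bieval l1 l2) (Gpoly 'X 'Y) = G l1 l2.
Proof.
rewrite /Gpoly map_mxB map_bieval_const2 [RHS]GmxE (map_block_mx _ ('Y)%:M).
rewrite !map_scalar_mx !map_mx0.
by rewrite /= /bieval !(hornerX, hornerC).
Qed.

Definition border (x : 'cV[C]_((m + m) + (n + n))) : 'M[C]_(_, 1 + 1) :=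
  row_mx x (rhsvec C m n).

Definition bordered x X Y :=
  block_mx (Gpoly X Y) (map_mx const2 (border x))
    (map_mx const2 ((border x)^T *m Smx C m n)) 0.

Section Sizes.
Variables (x : 'cV[C]_((m + m) + (n + n))) (X Y : {poly {poly C}}) (dx dy : nat).
Hypotheses (szX : (size X <= dx.+1)%N) (szY : (size Y <= dy.+1)%N).

Let szC c e : (size (const2 c) <= e.+1)%N.
Proof. exact: leq_trans (size_const2 c) _. Qed.

Let szB c (Z : {poly {poly C}}) e (b : bool) :
  (size Z <= e.+1)%N -> (size (const2 c - Z *+ b)%R <= e.+1)%N.
Proof.
move=> szZ; apply: (leq_trans (size_polyD _ _)); rewrite size_polyN geq_max szC /=.
by case: b; rewrite ?mulr1n ?mulr0n ?size_poly0.
Qed.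

(** The first 2m rows involve only [Y], the last 2n only [X]. The total is 2n for ('X, 'Y) and 2m
    for ('Y, 'X). *)
Definition row_degree (i : 'I_((m + m) + (n + n))) :=
  if split i is inl _ then dy else dx.

Lemma sum_row_degree : (\sum_i row_degree i = (m + m) * dy + (n + n) * dx)%N.
Proof.
have cstE N c : (N * c = \sum_(i < N) c)%N by rewrite sum_nat_const card_ord.
rewrite big_split_ord (cstE (m + m)%N) (cstE (n + n)%N); congr (_ + _)%N; apply: eq_bigr => i _.
  by rewrite /row_degree (unsplitK (inl _)).
by rewrite /row_degree (unsplitK (inr _)).
Qed.

Lemma size_Gpoly i j : (size (Gpoly X Y i j) <= (row_degree i).+1)%N.
Proof.
rewrite /row_degree /Gpoly -{1}[i]splitK -[j]splitK mxE mxE.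
rewrite [(- block_mx _ _ _ _) _ _]mxE.
case: (split i) => {}i; case: (split j) => {}j /=.
- by rewrite block_mxEul [_%:M _ _]mxE szB.
- by rewrite block_mxEur [(0 : 'M__) _ _]mxE subr0 szC.
- by rewrite block_mxEdl [(0 : 'M__) _ _]mxE subr0 szC.
- by rewrite block_mxEdr [_%:M _ _]mxE szB.
Qed.

Lemma size_det_Gpoly :
  (size (\det (Gpoly X Y)) <= ((m + m) * dy + (n + n) * dx).+1)%N.
Proof. by rewrite -sum_row_degree size_det_leq // => i j; apply: size_Gpoly. Qed.

Lemma size_det_bordered :
  (size (\det (bordered x X Y)) <= ((m + m) * dy + (n + n) * dx).+1)%N.
Proof.
pose d (i : 'I_((m + m) + (n + n) + (1 + 1))) :=
  if split i is inl k then row_degree k else 0%N.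
have -> : ((m + m) * dy + (n + n) * dx = \sum_i d i)%N.
  rewrite big_split_ord [X in _ = (_ + X)%N]big1 => [|i _]; last first.
    by rewrite /d (unsplitK (inr i)).
  rewrite addn0 -sum_row_degree; apply: eq_bigr => i _.
  by rewrite /d (unsplitK (inl _)).
apply: size_det_leq => i j; rewrite /d -{1}[i]splitK -[j]splitK /bordered.
case: (split i) => {}i; case: (split j) => {}j /=.
- by rewrite block_mxEul size_Gpoly.
- by rewrite block_mxEur mxE szC.
- by rewrite block_mxEdl mxE szC.
- by rewrite block_mxEdr mxE size_poly0.
Qed.

End Sizes.

Hypothesis g21E : g21 = - (Umx C n *m Jmx C n *m g12^T *m Jmx C m *m Umx C m).
Variable theta : {poly {poly C}}.
Hypothesis theta_sq : forall l1 l2 : C, peval2 theta l1 l2 ^+ 2 = \det (G l1 l2).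
Hypothesis theta_neq0 : theta != 0.

Lemma theta_sqr : theta ^+ 2 = \det (Gpoly 'X 'Y).
Proof.
apply/eqP; rewrite -subr_eq0; apply/eqP/bipoly_eq0 => l1 l2.
rewrite -/(bieval l1 l2 _) rmorphB rmorphXn /= -peval2E theta_sq.
by rewrite -det_map_mx bieval_Gpoly subrr.
Qed.

(** The border [x] is chosen because S^T S = 1: then x^T S is the i-th unit row, and [det_bordered]
    yields the square of the i-th entry of G^-1 r. The two sides are compared where det G is
    nonzero. *)
Lemma adj_sqr i (x := Smx C m n *m delta_mx i 0) :
  ((\adj (Gpoly 'X 'Y) *m map_mx const2 (rhsvec C m n)) i 0) ^+ 2
    = theta ^+ 2 * \det (bordered x 'X 'Y).
Proof.
rewrite theta_sqr; apply/eqP; rewrite -subr_eq0; apply/eqP.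
apply: (bipoly_eq0_generic (d := \det (Gpoly 'X 'Y))) => [|l1 l2].
  by rewrite -theta_sqr expf_neq0.
rewrite -![_.[_, _]]/(bieval l1 l2 _) -det_map_mx bieval_Gpoly => nz_det.
have uG : G l1 l2 \in unitmx by rewrite unitmxE unitfE.
rewrite rmorphB rmorphXn rmorphM /= -!det_map_mx bieval_Gpoly.
have -> : bieval l1 l2 ((\adj (Gpoly 'X 'Y) *m map_mx const2 (rhsvec C m n)) i 0)
          = (\adj (G l1 l2) *m rhsvec C m n) i 0.
  transitivity (map_mx (bieval l1 l2)
      (\adj (Gpoly 'X 'Y) *m map_mx const2 (rhsvec C m n)) i 0).
    by rewrite [RHS]mxE.
  by rewrite map_mxM map_mx_adj bieval_Gpoly map_bieval_const2.
rewrite /bordered map_block_mx map_mx0 bieval_Gpoly !map_bieval_const2.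
rewrite det_bordered ?tr_Smx ?Smx_Gmx //.
have -> : (x^T *m Smx C m n *m (invmx (G l1 l2) *m rhsvec C m n)) 0 0
          = (invmx (G l1 l2) *m rhsvec C m n) i 0.
  rewrite /x trmx_mul tr_Smx mulmxN mulNmx -mulmxA SmxK mulmxN mulmx1 opprK.
  by rewrite trmx_delta -rowE mxE.
rewrite /invmx uG -scalemxAl [X in _ * (_ * X ^+ 2)]mxE.
set u := (_ *m _) i 0; field; exact: nz_det.
Qed.

Lemma size_sqr_leq (R : idomainType) (p : {poly R}) k :
  (size (p ^+ 2) <= (k + k).+1)%N -> (size p <= k.+1)%N.
Proof.
have := size_exp p 2; have [->|nz_p] := eqVneq p 0; first by rewrite size_poly0.
have := expf_neq0 2 nz_p; rewrite -!size_poly_gt0 in nz_p *; lia.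
Qed.

Lemma swapXY_det_Gpoly : swapXY (\det (Gpoly 'X 'Y)) = \det (Gpoly 'Y 'X).
Proof.
rewrite -det_map_mx map_Gpoly => [|c]; last exact: swapXY_const2.
by rewrite /= swapXY_X swapXY_Y.
Qed.

Lemma swapXY_det_bordered x :
  swapXY (\det (bordered x 'X 'Y)) = \det (bordered x 'Y 'X).
Proof.
rewrite -det_map_mx map_block_mx map_mx0 map_Gpoly => [|c]; last exact: swapXY_const2.
rewrite /= swapXY_X swapXY_Y -!map_mx_comp.
by congr (\det (block_mx _ _ _ _)); apply: eq_map_mx => c; rewrite /= swapXY_const2.
Qed.

Lemma size_X1 : (size ('X : {poly {poly C}}) <= 2)%N.
Proof. by rewrite size_polyX. Qed.

Lemma size_Y0 : (size ('Y : {poly {poly C}}) <= 1)%N.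
Proof. exact: size_polyC_leq1. Qed.

Lemma size_theta : (size theta <= n.+1)%N.
Proof.
apply: size_sqr_leq; rewrite theta_sqr.
by have := size_det_Gpoly size_X1 size_Y0; rewrite muln0 muln1.
Qed.

Lemma sizeY_theta : (sizeY theta <= m.+1)%N.
Proof.
rewrite sizeYE; apply: size_sqr_leq; rewrite -rmorphXn /= theta_sqr swapXY_det_Gpoly.
by have := size_det_Gpoly size_Y0 size_X1; rewrite muln0 muln1 addn0.
Qed.

(** By [adj_sqr] and [bipoly_sqr_dvd], theta divides every entry of adj(G) r, and the square of the
    quotient is a bordered determinant, of bidegree at most (2n, 2m). *)
Lemma poly_solution_weak :
  exists Q : 'cV[{poly {poly C}}]_((m + m) + (n + n)),
  Gpoly 'X 'Y *m Q = theta *: map_mx const2 (rhsvec C m n) /\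
  forall i, (size (Q i 0%R) <= n.+1)%N /\ (sizeY (Q i 0%R) <= m.+1)%N.
Proof.
have [q /= Dq Eq] := fin_all_exists2 (fun i => bipoly_sqr_dvd theta_neq0 (adj_sqr i)).
exists (\col_i q i); split.
  (* After multiplication by theta this is G adj(G) r = theta^2 r. *)
  apply/matrixP=> i j; rewrite (ord1 j); apply: (mulfI theta_neq0).
  have Eadj : \adj (Gpoly 'X 'Y) *m map_mx const2 (rhsvec C m n)
              = theta *: (\col_i q i).
    by apply/matrixP=> k l; rewrite (ord1 l) Dq !mxE.
  have := congr1 (mulmx (Gpoly 'X 'Y)) Eadj.
  rewrite mulmxA mul_mx_adj -theta_sqr -scalemxAr => /matrixP/(_ i 0).
  rewrite mul_scalar_mx !mxE => <-; ring.
move=> i; rewrite mxE sizeYE; split.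
  apply: size_sqr_leq; rewrite Eq.
  by have := size_det_bordered (Smx C m n *m delta_mx i 0) size_X1 size_Y0;
     rewrite muln0 muln1.
apply: size_sqr_leq; rewrite -rmorphXn /= Eq swapXY_det_bordered.
by have := size_det_bordered (Smx C m n *m delta_mx i 0) size_Y0 size_X1;
   rewrite muln0 muln1 addn0.
Qed.

Lemma size_mulX_leq (R : idomainType) (p : {poly R}) k :
  (size ('X * p)%R <= k.+1)%N -> (size p <= k)%N.
Proof.
by have [->|nz_p] := eqVneq p 0; rewrite ?size_poly0 // mulrC size_mulX.
Qed.

(* The equations (calA - l)Q_b + ... = theta r, read as l Q_b = ..., show that
   the two blocks of Q lose one degree in their own variable. *)
Lemma poly_solution :
  exists Q : 'cV[{poly {poly C}}]_((m + m) + (n + n)),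
  [/\ forall l1 l2,
        G l1 l2 *m map_mx (bieval l1 l2) Q = bieval l1 l2 theta *: rhsvec C m n,
     forall i, (size (Q (lshift _ i) 0%R) <= n.+1)%N /\ (sizeY (Q (lshift _ i) 0%R) <= m)%N
   & forall j, (size (Q (rshift _ j) 0%R) <= n)%N /\ (sizeY (Q (rshift _ j) 0%R) <= m.+1)%N].
Proof.
have [Q [GQ szQ]] := poly_solution_weak.
have DQ : block_mx 'Y%:M 0 0 'X%:M *m Q
    = map_mx const2 (G 0 0) *m Q - theta *: map_mx const2 (rhsvec C m n).
  by rewrite -GQ /Gpoly mulmxBl opprB addrC subrK.
have DQl i : 'Y * Q (lshift _ i) 0 = (map_mx const2 (G 0 0) *m Q) (lshift _ i) 0
                             - theta * const2 (rhsvec C m n (lshift _ i) 0).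
  move/matrixP/(_ (lshift _ i) 0): DQ.
  rewrite -{1}[Q]vsubmxK mul_block_col !mul0mx addr0 add0r col_mxEu mul_scalar_mx.
  by rewrite [LHS]mxE [X in _ * X]mxE => ->; rewrite [LHS]mxE; congr (_ + _); rewrite !mxE.
have DQr i : 'X * Q (rshift _ i) 0 = (map_mx const2 (G 0 0) *m Q) (rshift _ i) 0
                             - theta * const2 (rhsvec C m n (rshift _ i) 0).
  move/matrixP/(_ (rshift _ i) 0): DQ.
  rewrite -{1}[Q]vsubmxK mul_block_col !mul0mx addr0 add0r col_mxEd mul_scalar_mx.
  by rewrite [LHS]mxE [X in _ * X]mxE => ->; rewrite [LHS]mxE; congr (_ + _); rewrite !mxE.
have size_sub (A B : {poly {poly C}}) c N :
    (size A <= N)%N -> (size B <= N)%N -> (size (A - B * const2 c)%R <= N)%N.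
  move=> szA szB; rewrite (leq_trans (size_polyD _ _)) // size_polyN geq_max szA.
  by rewrite mulrC mul_polyC (leq_trans (size_scale_leq _ _)).
exists Q; split=> [l1 l2|i|j].
- move/(congr1 (map_mx (bieval l1 l2))): GQ.
  by rewrite map_mxM bieval_Gpoly map_mxZ map_bieval_const2.
- have [szXQ _] := szQ (lshift _ i); split=> //; rewrite sizeYE.
  apply: size_mulX_leq; rewrite -swapXY_Y -rmorphM /= DQl rmorphB rmorphM /=.
  rewrite swapXY_const2; apply: size_sub; last by rewrite -sizeYE sizeY_theta.
  have -> : swapXY ((map_mx const2 (G 0 0) *m Q) (lshift _ i) 0)
      = (map_mx const2 (G 0 0) *m map_mx swapXY Q) (lshift _ i) 0.
    rewrite !mxE rmorph_sum; apply: eq_bigr => k _; rewrite !mxE rmorphM /=.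
    by rewrite swapXY_const2.
  by apply: size_map_const2_mul => k; rewrite mxE -sizeYE; case: (szQ k).
have [_ szYQ] := szQ (rshift _ j); split=> //.
apply: size_mulX_leq; rewrite DQr size_sub ?size_theta //.
by apply: size_map_const2_mul => k; case: (szQ k).
Qed.

End PolynomialSolution.

(** * Coefficients in the Cayley variable *)

Section Almost.
Variable T : eqType.

(** When nested, the finite exceptional set of an inner variable may depend on the outer ones, as it
    does for zero sets of polynomials in several variables. *)
Definition almost (P : T -> Prop) := exists s : seq T, forall x, x \notin s -> P x.

Lemma almost_imp (P Q : T -> Prop) : (forall x, P x -> Q x) -> almost P -> almost Q.
Proof. by move=> PQ [s Ps]; exists s => x /Ps/PQ. Qed.

Lemma almost_and (P Q : T -> Prop) :
  almost P -> almost Q -> almost (fun x => P x /\ Q x).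
Proof.
move=> [s Ps] [t Qt]; exists (s ++ t) => x; rewrite mem_cat negb_or.
by case/andP=> /Ps ? /Qt.
Qed.

Lemma almost_neq (y : T) : almost (fun x => x != y).
Proof. by exists [:: y] => x; rewrite inE. Qed.

End Almost.

(** * Block indices as quotient and remainder *)

Section SumDivMod.

Lemma ord_divn_lt m N (K : 'I_(m * N)) : (0 < m)%N /\ (K %/ m < N)%N.
Proof.
have ltK := ltn_ord K; have /andP[m_gt0 _] : (0 < m)%N && (0 < N)%N.
  by rewrite -muln_gt0; apply: leq_ltn_trans ltK.
by rewrite ltn_divLR // [(N * m)%N]mulnC.
Qed.

Lemma sum_divmod (V : nmodType) m N (F : nat -> nat -> V) :
  \sum_(K < m * N) F (K %/ m)%N (K %% m)%N = \sum_(i < N) \sum_(j < m) F i j.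
Proof.
rewrite -(big_mkord xpredT (fun K => F (K %/ m)%N (K %% m)%N)) mulnC big_nat_mul.
rewrite big_mkord; apply: eq_bigr => i _.
rewrite -{1}[(i * m)%N]add0n big_addn mulSn addnK big_mkord; apply: eq_bigr => j _.
have m_gt0 : (0 < m)%N by apply: leq_trans (ltn_ord j).
by rewrite addnC divnMDl // modnMDl divn_small ?modn_small ?addn0.
Qed.

Lemma row_divmod (R : pzRingType) m N (u : 'rV[R]_(m * N)) :
  exists f : nat -> nat -> R, forall K : 'I_(m * N), u 0 K = f (K %/ m)%N (K %% m)%N.
Proof.
(* Where [i * m + j] is not an index, the function defaults to 0. *)
exists (fun i j => if insub (i * m + j)%N is Some K then u 0 K else 0) => K.
by rewrite -divn_eq valK.
Qed.

End SumDivMod.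

(** * Monomial vectors in Cayley variables *)

Section Cayley.
Variable C : numClosedFieldType.

Lemma almost_nonroot (p : {poly C}) : p != 0 -> almost (fun x => p.[x] != 0).
Proof.
move=> nz_p; have [r Dp] := closed_field_poly_normal p; exists r => x.
apply: contraNneq => /rootP; rewrite Dp rootZ ?lead_coef_eq0 //.
by rewrite root_prod_XsubC.
Qed.

(** Off the roots of the leading coefficient, specialising the inner variable leaves a nonzero
    polynomial in the outer one. *)
Lemma almost_nonroot2 (p : {poly {poly C}}) :
  p != 0 -> almost (fun l2 => almost (fun l1 => p.[l1, l2] != 0)).
Proof.
move=> nz_p; have nz_c : lead_coef p != 0 by rewrite lead_coef_eq0.
apply: almost_imp (almost_nonroot nz_c) => l2 nz_cl2.
have nz_pl2 : map_poly (horner_eval l2) p != 0.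
  apply: contraNneq nz_cl2 => /polyP/(_ (size p).-1).
  by rewrite coef_map coef0 /= => <-.
apply: almost_imp (almost_nonroot nz_pl2) => l1.
by rewrite -horner_swapXY horner2_swapXY.
Qed.

Definition cayley (a l : C) := (l + a) / (l - a).

(** The Cayley map takes every value except 1. The factor [q] vanishes at 1 and at the images of the
    exceptional points, so that p q vanishes everywhere. *)
Lemma almost_cayley_eq0 a (p : {poly C}) :
  a != 0 -> almost (fun x => p.[cayley a x] = 0) -> p = 0.
Proof.
move=> nz_a [s ps0]; pose q := ('X - 1%:P) * \prod_(y <- s) ('X - (cayley a y)%:P).
have nz_q : q != 0.
  rewrite mulf_neq0 ?polyXsubC_eq0 //; elim/big_ind: _ => [||y _].
  - exact: oner_neq0.
  - exact: mulf_neq0.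
  - by rewrite polyXsubC_eq0.
suffices /eqP : p * q = 0 by rewrite mulf_eq0 (negPf nz_q) orbF => /eqP.
apply: poly_eq0 => z; rewrite !hornerM hornerXsubC horner_prod.
have [->|nz_z] := eqVneq z 1; first by rewrite subrr mul0r mulr0.
have nz_z1 : z - 1 != 0 by rewrite subr_eq0.
pose x := a * (z + 1) / (z - 1).
have zE : cayley a x = z.
  have -> : cayley a x = (2%:R * a * z / (z - 1)) / (2%:R * a / (z - 1)).
    by rewrite /cayley /x; congr (_ / _); field.
  by field; rewrite nz_z1 nz_a.
have [x_s|/ps0] := boolP (x \in s); last by rewrite zE => ->; rewrite mul0r.
rewrite (big_rem x x_s) /= zE hornerXsubC subrr; ring.
Qed.

Definition vander m N (x1 x2 : C) : 'cV[C]_(m * N) :=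
  \col_K (x1 ^+ (K %/ m)%N * x2 ^+ (K %% m)%N).

(** One variable at a time: first x1 for generic fixed x2, then x2 in each coefficient. *)
Lemma vander_eq0 a m N (u : 'rV[C]_(m * N)) : a != 0 ->
    almost (fun x2 => almost (fun x1 =>
      (u *m vander m N (cayley a x1) (cayley a x2)) 0 0 = 0)) ->
  u = 0.
Proof.
move=> nz_a u0; have [f Df] := row_divmod u.
have rowE x1 x2 : (u *m vander m N x1 x2) 0 0
    = \sum_(i < N) (\sum_(j < m) f i j * x2 ^+ j) * x1 ^+ i.
  rewrite mxE -[RHS](eq_bigr _ (fun i _ => esym (mulr_suml _ _ _ _))).
  rewrite -(sum_divmod m N (fun i j => f i j * x2 ^+ j * x1 ^+ i)).
  by apply: eq_bigr => K _; rewrite mxE Df -mulrA [_ ^+ _ * _]mulrC.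
apply/rowP=> K; rewrite Df mxE.
have [m_gt0 Kdiv] := ord_divn_lt K.
have Kmod : (K %% m < m)%N by rewrite ltn_mod.
pose p := \poly_(j < m) f (K %/ m)%N j.
suffices p0 : p = 0 by have := coef_poly m (f (K %/ m)%N) (K %% m)%N; rewrite -/p p0 coef0 Kmod.
apply: (almost_cayley_eq0 nz_a); apply: almost_imp u0 => x2 u0.
pose q := \poly_(i < N) (\sum_(j < m) f i j * cayley a x2 ^+ j).
have q0 : q = 0.
  apply: (almost_cayley_eq0 nz_a); apply: almost_imp u0 => x1.
  by rewrite rowE horner_poly.
have := coef_poly N (fun i => \sum_(j < m) f i j * cayley a x2 ^+ j) (K %/ m)%N.
by rewrite -/q q0 coef0 Kdiv horner_poly.
Qed.

Lemma vander_form_eq0 a b m N p (X : 'M[C]_(m * N, m * p)) : a != 0 -> b != 0 ->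
    almost (fun m2 => almost (fun m1 => almost (fun l2 => almost (fun l1 =>
      ((vander m N (cayley a m1) (cayley a m2))^T *m X
         *m vander m p (cayley b l1) (cayley b l2)) 0 0 = 0)))) ->
  X = 0.
Proof.
move=> nz_a nz_b X0; apply/trmx_inj/row_matrixP=> k; rewrite trmx0 row0.
apply: (vander_eq0 nz_a); apply: almost_imp X0 => m2; apply: almost_imp => m1.
move/(vander_eq0 nz_b)/matrixP/(_ 0 k); rewrite [RHS]mxE => X0.
by rewrite mxE -[RHS]X0 mxE; apply: eq_bigr => i _; rewrite !mxE mulrC.
Qed.

(* l / (l - a) and 1 / (l - a) are affine functions of z = (l + a) / (l - a), so
   that l ^ k / (l - a) ^ N is a polynomial in z of degree at most N. *)
Definition cayley_basis (a : C) N k : {poly C} :=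
  (2%:R^-1 *: ('X + 1%:P)) ^+ k * ((2%:R * a)^-1 *: ('X - 1%:P)) ^+ (N - k).

Lemma size_cayley_basis a N k : (k <= N)%N -> (size (cayley_basis a N k) <= N.+1)%N.
Proof.
move=> le_kN; have szL c (b : C) : (size (c *: ('X + b%:P)) <= 2)%N.
  by rewrite (leq_trans (size_scale_leq _ _)) // size_XaddC.
have szX c (b : C) d : (size ((c *: ('X + b%:P)) ^+ d)%R <= d.+1)%N.
  apply: (leq_trans (size_poly_exp_leq _ _)); rewrite ltnS -[leqRHS]mul1n leq_mul2r.
  by have := szL c b; case: (size _) => [|[|[|]]] // _; rewrite ?orbT.
apply: (leq_trans (size_polyMleq _ _)).
have := szX 2%:R^-1 1 k; have := szX (2%:R * a)^-1 (- 1) (N - k)%N.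
rewrite polyCN; move: (size _) (size _) => s1 s2; lia.
Qed.

Lemma cayley_basisE a N k l : a != 0 -> l != a -> (k <= N)%N ->
  (cayley_basis a N k).[cayley a l] = l ^+ k / (l - a) ^+ N.
Proof.
move=> nz_a ne_la le_kN; have nz_la : l - a != 0 by rewrite subr_eq0.
rewrite /cayley_basis hornerM !horner_exp !hornerZ !hornerD hornerN !hornerC hornerX.
have -> : 2%:R^-1 * (cayley a l + 1) = l / (l - a).
  by rewrite /cayley; field.
have -> : (2%:R * a)^-1 * (cayley a l - 1) = (l - a)^-1.
  by rewrite /cayley; field; rewrite nz_a nz_la.
by rewrite -{2}(subnK le_kN) exprD expr_div_n exprVn invfM; ring.
Qed.

(** Coefficients of q(l1, l2) / ((l1 - a)^n (l2 - a)^(m-1)) in the monomials of the two Cayley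
    variables, the first variable giving the block index. *)
Definition expansion (a : C) m n (q : {poly {poly C}}) : 'rV[C]_(m * n.+1) :=
  \row_K \sum_(i < n.+1) \sum_(j < m)
    q`_i`_j * (cayley_basis a n i)`_(K %/ m)%N * (cayley_basis a m.-1 j)`_(K %% m)%N.

Lemma expansionE (a : C) m n (q : {poly {poly C}}) l1 l2 : a != 0 -> (0 < m)%N ->
    (size q <= n.+1)%N -> (sizeY q <= m)%N -> l1 != a -> l2 != a ->
  (expansion a m n q *m vander m n.+1 (cayley a l1) (cayley a l2)) 0 0
    = q.[l1, l2] / ((l1 - a) ^+ n * (l2 - a) ^+ m.-1).
Proof.
move=> nz_a m_gt0 szq szYq ne1 ne2.
have qE : q.[l1, l2] = \sum_(i < n.+1) \sum_(j < m) q`_i`_j * l1 ^+ i * l2 ^+ j.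
  rewrite -(horner2_swapXY q) horner_swapXY (horner_coef_wide _ (n := n.+1)); last first.
    exact: leq_trans (size_poly _ _) szq.
  apply: eq_bigr => i _; rewrite coef_map /= /horner_eval.
  rewrite (horner_coef_wide _ (leq_trans (max_size_coefXY _ _) szYq)) mulr_suml.
  by apply: eq_bigr => j _; ring.
rewrite mxE qE mulr_suml.
under eq_bigr do rewrite !mxE mulr_suml.
rewrite exchange_big; apply: eq_bigr => i _ /=.
under eq_bigr do rewrite mulr_suml.
rewrite exchange_big mulr_suml; apply: eq_bigr => j _ /=.
have le_i : (i <= n)%N by rewrite -ltnS.
have le_j : (j <= m.-1)%N by rewrite -ltnS prednK.
transitivity (q`_i`_j * (cayley_basis a n i).[cayley a l1]
                      * (cayley_basis a m.-1 j).[cayley a l2]); last first.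
  by rewrite !cayley_basisE // invfM; ring.
rewrite (horner_coef_wide _ (size_cayley_basis a le_i)).
rewrite (horner_coef_wide _ (size_cayley_basis a le_j)) prednK //.
rewrite (sum_divmod m n.+1 (fun k l => q`_i`_j * (cayley_basis a n i)`_k
  * (cayley_basis a m.-1 j)`_l * (cayley a l1 ^+ k * cayley a l2 ^+ l))).
rewrite [X in _ = X * _]mulr_sumr mulr_suml; apply: eq_bigr => k _.
by rewrite mulr_sumr; apply: eq_bigr => l _; ring.
Qed.

End Cayley.

(** * Displacement structure and its inverse *)

Section Selection.
Variable F : fieldType.

(** On the left [sel f] extracts the rows [f i]; on the right, for injective [f], it moves column i
    to position [f i] and fills up with zeros. *)
Definition sel N L (f : 'I_N -> 'I_L) : 'M[F]_(N, L) := \matrix_(i, j) (f i == j)%:R.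

Lemma mul_selE N L p (f : 'I_N -> 'I_L) (A : 'M_(L, p)) i j :
  (sel f *m A) i j = A (f i) j.
Proof.
rewrite mxE (bigD1 (f i)) //= mxE eqxx mul1r big1 ?addr0 // => k.
by rewrite mxE eq_sym => /negPf ->; rewrite mul0r.
Qed.

Lemma mulmx_tr_selE N L p (f : 'I_N -> 'I_L) (A : 'M_(p, L)) i j :
  (A *m (sel f)^T) i j = A i (f j).
Proof. by rewrite -[A]trmxK -trmx_mul mxE mul_selE trmxK mxE. Qed.

Lemma mulmx_sel_inj N L p (f : 'I_N -> 'I_L) (A : 'M_(p, N)) i j :
  injective f -> (A *m sel f) i (f j) = A i j.
Proof.
move=> f_inj; rewrite mxE (bigD1 j) //= mxE eqxx mulr1 big1 ?addr0 // => k.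
by rewrite mxE (inj_eq f_inj) => /negPf ->; rewrite mulr0.
Qed.

Lemma mulmx_sel_out N L p (f : 'I_N -> 'I_L) (A : 'M_(p, N)) i l :
  (forall j, f j <> l) -> (A *m sel f) i l = 0.
Proof.
move=> f_l; rewrite mxE big1 // => k _; rewrite mxE.
by case: eqP => [/f_l//|_]; rewrite mulr0.
Qed.

(** In the application [e] and [f] (later [lo] and [hi]) embed a row of blocks as the first and as
    the last blocks of a row one block longer; [e'] and [f'] do so one level below. The hypotheses
    say that the two images meet in the common blocks and cover everything. *)
Variables (N L p : nat) (e f : 'I_N -> 'I_L) (e' f' : 'I_p -> 'I_N).
Hypotheses (e_inj : injective e) (f_inj : injective f).
Hypotheses (e'_inj : injective e') (f'_inj : injective f').
Hypothesis ef : forall P, e (f' P) = f (e' P).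
Hypothesis ef_meet : forall K K', e K = f K' -> exists2 P, K = f' P & K' = e' P.
Hypothesis ef_cover : forall l, (exists K, e K = l) \/ (exists K, f K = l).

(** For [lo] and [hi]: R padded with zeros at the end, minus R padded at the beginning. On
    generating functions it is multiplication by 1 - w1 z1 ([form_displacement]). *)
Definition displacement (R : 'M[F]_N) : 'M[F]_L :=
  (sel e)^T *m R *m sel e - (sel f)^T *m R *m sel f.

(** The common value is supported on the images of [e] and of [f], hence on their intersection,
    which [ef_meet] parametrises. *)
Lemma sel_factor r (x y : 'M[F]_(r, N)) : x *m sel e = y *m sel f ->
  exists2 Y, x = Y *m sel f' & y = Y *m sel e'.
Proof.
move=> xy; have xyE i l : (x *m sel e) i l = (y *m sel f) i l by rewrite xy.
exists (x *m (sel f')^T); apply/matrixP=> i K.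
  case: (pickP (fun P => f' P == K)) => [P /eqP <-|nK].
    by rewrite mulmx_sel_inj // mulmx_tr_selE.
  rewrite [RHS]mulmx_sel_out => [|P]; last by move/eqP; rewrite nK.
  rewrite -(mulmx_sel_inj x i K e_inj) xyE mulmx_sel_out // => K' /esym/ef_meet[P DK _].
  by have := nK P; rewrite DK eqxx.
case: (pickP (fun P => e' P == K)) => [P /eqP <-|nK].
  rewrite mulmx_sel_inj // mulmx_tr_selE -(mulmx_sel_inj x i _ e_inj) xyE ef.
  by rewrite mulmx_sel_inj.
rewrite [RHS]mulmx_sel_out => [|P]; last by move/eqP; rewrite nK.
rewrite -(mulmx_sel_inj y i K f_inj) -xyE mulmx_sel_out // => K' /ef_meet[P _ DK].
by have := nK P; rewrite DK eqxx.
Qed.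

(* With E = sel e, F = sel f, E' = sel e', F' = sel f': a row v killed by the
   displacement of R satisfies v E^T R E = v F^T R F; by
   [sel_factor] both sides come from one row Y, and v E^T = Y F' T, v F^T = Y E' T
   with T the inverse of R.  The rank bound makes Y range over everything. *)
Lemma displacement_inv_shift (R T : 'M[F]_N) :
    R *m T = 1%:M -> (p + \rank (displacement R) <= L)%N ->
  forall P Q, T (f' P) (f' Q) = T (e' P) (e' Q).
Proof.
set M := displacement R => RT rkM.
pose V := row_base (kermx M).
have VM : V *m M = 0 by apply/sub_kermxP; rewrite eq_row_base.
have [Y xY yY] : exists2 Y, V *m (sel e)^T *m R = Y *m sel f'
                          & V *m (sel f)^T *m R = Y *m sel e'.
  apply: sel_factor; apply/eqP; rewrite -subr_eq0.
  by rewrite -VM /M /displacement mulmxBr !mulmxA.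
have xT : V *m (sel e)^T = Y *m sel f' *m T by rewrite -xY -mulmxA RT mulmx1.
have yT : V *m (sel f)^T = Y *m sel e' *m T by rewrite -yY -mulmxA RT mulmx1.
(* If u Y = 0, then u V vanishes on both images, hence everywhere, while the rows of V are
   independent. *)
have freeY : row_free Y.
  apply: inj_row_free => u uY; apply: (row_free_inj (row_base_free _)); rewrite mul0mx.
  have uE : u *m V *m (sel e)^T = 0 by rewrite -mulmxA xT !mulmxA uY !mul0mx.
  have uF : u *m V *m (sel f)^T = 0 by rewrite -mulmxA yT !mulmxA uY !mul0mx.
  apply/matrixP=> i l; rewrite [RHS]mxE; case: (ef_cover l) => [] [K <-].
    by rewrite -mulmx_tr_selE uE mxE.
  by rewrite -mulmx_tr_selE uF mxE.
(* [Y] has [L - \rank M] independent rows in dimension [p]; the rank hypothesis makes this number at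
   least [p]. *)
have fullY : row_full Y.
  rewrite /row_full eqn_leq rank_leq_col (eqP freeY) mxrank_ker; lia.
have sel_comm : (sel e)^T *m (sel f')^T = (sel f)^T *m (sel e')^T.
  by rewrite -!trmx_mul; congr trmx; apply/matrixP=> i j; rewrite !mul_selE !mxE ef.
have /(row_full_inj fullY)/matrixP TE :
    Y *m (sel f' *m T *m (sel f')^T) = Y *m (sel e' *m T *m (sel e')^T).
  by rewrite !mulmxA -xT -yT -!mulmxA sel_comm.
by move=> P Q; have := TE P Q; rewrite !mulmx_tr_selE !mul_selE.
Qed.

End Selection.

(** * Translation by one block *)

Section Blocks.

Fact lo_subproof m N (K : 'I_(m * N)) : (K < m * N.+1)%N.
Proof. by rewrite mulnS ltn_addl. Qed.

Fact hi_subproof m N (K : 'I_(m * N)) : (m + K < m * N.+1)%N.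
Proof. by rewrite mulnS ltn_add2l. Qed.

Definition lo m N (K : 'I_(m * N)) : 'I_(m * N.+1) := Ordinal (lo_subproof K).
Definition hi m N (K : 'I_(m * N)) : 'I_(m * N.+1) := Ordinal (hi_subproof K).

Lemma lo_inj m N : injective (@lo m N).
Proof. by move=> K K' /(congr1 val) /= /val_inj. Qed.

Lemma hi_inj m N : injective (@hi m N).
Proof. by move=> K K' /(congr1 val) /= /addnI /val_inj. Qed.

Lemma lo_hi m N (K : 'I_(m * N)) : lo (hi K) = hi (lo K).
Proof. exact: val_inj. Qed.

Lemma lo_hi_meet m N (K K' : 'I_(m * N.+1)) : lo K = hi K' ->
  exists2 P : 'I_(m * N), K = hi P & K' = lo P.
Proof.
move/(congr1 val) => /= DK; have ltK' : (K' < m * N)%N.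
  by have := ltn_ord K; rewrite DK [X in (_ < X)%N -> _]mulnS ltn_add2l.
by exists (Ordinal ltK'); apply: val_inj.
Qed.

Lemma lo_hi_cover m N (l : 'I_(m * N.+2)) :
  (exists K, @lo m N.+1 K = l) \/ (exists K, @hi m N.+1 K = l).
Proof.
have [lt_l|ge_l] := ltnP l (m * N.+1); first by left; exists (Ordinal lt_l); apply: val_inj.
have le_ml : (m <= l)%N by apply: leq_trans ge_l; rewrite leq_pmulr.
have lt_l : (l - m < m * N.+1)%N.
  by rewrite ltn_subLR // -mulnS.
by right; exists (Ordinal lt_l); apply: val_inj; rewrite /= subnKC.
Qed.

Variable C : numClosedFieldType.

Lemma sel_lo_vander m N (x1 x2 : C) :
  sel C (@lo m N) *m vander m N.+1 x1 x2 = vander m N x1 x2.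
Proof. by apply/matrixP=> K j; rewrite mul_selE !mxE. Qed.

Lemma sel_hi_vander m N (x1 x2 : C) :
  sel C (@hi m N) *m vander m N.+1 x1 x2 = x1 *: vander m N x1 x2.
Proof.
apply/matrixP=> K j; rewrite mul_selE !mxE /=.
have [m_gt0 _] := ord_divn_lt K.
by rewrite divnDl ?dvdnn // divnn m_gt0 modnDl add1n exprS mulrA.
Qed.

Local Notation form w1 w2 X z1 z2 N :=
  (((vander _ N w1 w2)^T *m X *m vander _ N z1 z2) 0 0).

Lemma form_displacement m N (R : 'M[C]_(m * N)) w1 w2 z1 z2 :
  form w1 w2 (displacement (@lo m N) (@hi m N) R) z1 z2 N.+1
    = (1 - w1 * z1) * form w1 w2 R z1 z2 N.
Proof.
have lo_tr : (vander m N.+1 w1 w2)^T *m (sel C (@lo m N))^T = (vander m N w1 w2)^T.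
  by rewrite -trmx_mul sel_lo_vander.
have hi_tr : (vander m N.+1 w1 w2)^T *m (sel C (@hi m N))^T = w1 *: (vander m N w1 w2)^T.
  by rewrite -trmx_mul sel_hi_vander linearZ.
rewrite /displacement mulmxBr mulmxBl !mulmxA lo_tr hi_tr -!mulmxA.
rewrite sel_lo_vander sel_hi_vander -!scalemxAr -scalemxAl.
rewrite [LHS]mxE [X in _ + X]mxE [X in _ - X]mxE [X in _ - _ * X]mxE; ring.
Qed.

(** Generic values determine the displacement, which is therefore [Pc^T *m Qc], of rank at most 2m.
    As m N + 2m = m (N + 2), this is just what [displacement_inv_shift] requires. *)
Lemma inv_displacement_shift m N b1 b2 (R T : 'M[C]_(m * N.+1))
    (Pc Qc : 'M[C]_(m + m, m * N.+2)) : b1 != 0 -> b2 != 0 ->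
    R *m T = 1%:M ->
    almost (fun m2 => almost (fun m1 => almost (fun l2 => almost (fun l1 =>
      (1 - cayley b1 m1 * cayley b2 l1)
        * form (cayley b1 m1) (cayley b1 m2) R (cayley b2 l1) (cayley b2 l2) N.+1
      = form (cayley b1 m1) (cayley b1 m2) (Pc^T *m Qc)
             (cayley b2 l1) (cayley b2 l2) N.+2)))) ->
  forall P Q, T (@hi m N P) (@hi m N Q) = T (lo P) (lo Q).
Proof.
move=> nz_b1 nz_b2 RT eqR.
apply: (displacement_inv_shift (@lo_inj _ _) (@hi_inj _ _) (@lo_inj _ _) (@hi_inj _ _)
  (@lo_hi _ _) (@lo_hi_meet _ _) (@lo_hi_cover _ _) RT).
suffices -> : displacement (@lo m N.+1) (@hi m N.+1) R = Pc^T *m Qc.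
  apply: leq_trans (_ : (m * N + (m + m) <= _)%N); last by rewrite !mulnS addnC addnA.
  rewrite leq_add2l; apply: leq_trans (mxrankM_maxr _ _) _.
  exact: rank_leq_row.
apply/eqP; rewrite -subr_eq0; apply/eqP; apply: (vander_form_eq0 nz_b1 nz_b2).
apply: almost_imp eqR => m2; apply: almost_imp => m1; apply: almost_imp => l2.
apply: almost_imp => l1 /=; rewrite -form_displacement => eqR.
by rewrite mulmxBr mulmxBl mxE eqR [X in _ + X]mxE subrr.
Qed.

End Blocks.

(** * Exact division by 1 - w z *)

Section Bezout.
Variable C : numClosedFieldType.

(* Coefficients of the power series M(w, z) / (1 - w z). *)
Fixpoint diagonal_sum (M : nat -> nat -> C) k l : C :=
  M k l + (if k is k'.+1 then if l is l'.+1 then diagonal_sum M k' l' else 0 else 0).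

(** D = [diagonal_sum M] satisfies D(k,l) - D(k-1,l-1) = M(k,l), with D zero at negative indices,
    and multiplication by w z shifts both indices. *)
Lemma diagonal_sum_telescope (M : nat -> nat -> C) N (w z : C) :
  \sum_(k < N.+1) \sum_(l < N.+1) M k l * w ^+ k * z ^+ l
    = \sum_(k < N.+1) \sum_(l < N.+1) diagonal_sum M k l * w ^+ k * z ^+ l
      - w * z * \sum_(k < N) \sum_(l < N) diagonal_sum M k l * w ^+ k * z ^+ l.
Proof.
have shiftE : w * z * \sum_(k < N) \sum_(l < N) diagonal_sum M k l * w ^+ k * z ^+ l
   = \sum_(k < N.+1) \sum_(l < N.+1)
      (if (k : nat) is k'.+1 then if (l : nat) is l'.+1 then diagonal_sum M k' l' else 0 else 0 : C)
       * w ^+ k * z ^+ l.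
  rewrite big_ord_recl [X in _ = X + _]big1 => [|l _]; last by rewrite !mul0r.
  rewrite add0r mulr_sumr; apply: eq_bigr => k _.
  rewrite big_ord_recl /= !mul0r add0r mulr_sumr; apply: eq_bigr => l _.
  by rewrite /= !exprS; ring.
rewrite shiftE -sumrB; apply: eq_bigr => k _; rewrite -sumrB; apply: eq_bigr => l _.
by case: k l => [[|k] ?] [[|l] ?] /=; ring.
Qed.

Lemma border_sum N (A : nat -> nat -> C) :
  \sum_(k < N.+1) \sum_(l < N.+1) A k l - \sum_(k < N) \sum_(l < N) A k l
    = \sum_(k < N) A k N + \sum_(l < N.+1) A N l.
Proof.
rewrite big_ord_recr /= addrAC -sumrB; congr (_ + _).
by apply: eq_bigr => k _; rewrite big_ord_recr /= addrAC subrr add0r.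
Qed.

Lemma cayleyN (a l : C) : cayley (- a) l = (cayley a l)^-1.
Proof. by rewrite /cayley opprK invf_div. Qed.

(** Here w z = 1, so telescoping leaves only the last row and column of D. Multiplied by z^N they
    form a polynomial with coefficient D(N,l) at z^l and D(k,N) at z^(2N-k), which vanishes. *)
Lemma diagonal_sum_eq0 (a : C) (M : nat -> nat -> C) N : a != 0 ->
    almost (fun x => \sum_(k < N.+1) \sum_(l < N.+1)
       M k l * cayley (- a) x ^+ k * cayley a x ^+ l = 0) ->
  forall k, (k <= N)%N -> diagonal_sum M N k = 0 /\ diagonal_sum M k N = 0.
Proof.
move=> nz_a M0; set D := diagonal_sum M.
pose p := \poly_(i < (N + N).+1) (if (i <= N)%N then D N i else D (N + N - i)%N N).
have p0 : p = 0.
  apply: (almost_cayley_eq0 nz_a).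
  have := almost_and (almost_and (almost_neq a) (almost_neq (- a))) M0.
  apply: almost_imp => x [[ne_a ne_na]]; rewrite diagonal_sum_telescope -/D.
  rewrite cayleyN; set z := cayley a x.
  have nz_z : z != 0.
    by rewrite mulf_neq0 ?invr_eq0 ?subr_eq0 // -[a]opprK subr_eq0.
  rewrite mulVf // mul1r (border_sum _ (fun k l => D k l * z^-1 ^+ k * z ^+ l)) => HD.
  transitivity (z ^+ N * 0); last by rewrite mulr0.
  rewrite -HD horner_poly -addSn big_split_ord mulrDr addrC /=; congr (_ + _).
    rewrite mulr_sumr; apply: eq_bigr => l _ /=.
    by rewrite -ltnS ltn_ord exprVn; field; rewrite expf_neq0.
  rewrite (reindex_inj rev_ord_inj) mulr_sumr; apply: eq_bigr => k _ /=.
  have lt_k := ltn_ord k.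
  rewrite (_ : (N.+1 + (N - k.+1) = N + N - k)%N); last by lia.
  rewrite (_ : (N + N - k <= N)%N = false); last by lia.
  rewrite (_ : (N + N - (N + N - k) = k)%N); last by lia.
  rewrite -addnBA ?(ltnW lt_k) // exprD exprVn.
  rewrite (_ : z ^+ N = z ^+ (N - k) * z ^+ k); last by rewrite -exprD subnK // ltnW.
  by field; rewrite expf_neq0.
move=> k le_kN; have coefp i := congr1 (fun q : {poly C} => q`_i) p0.
have le_kNN : (k <= N + N)%N by apply: leq_trans le_kN (leq_addr _ _).
split; first by have := coefp k; rewrite coef_poly coef0 ltnS le_kNN le_kN.
have := coefp (N + N - k)%N; rewrite coef_poly coef0 ltnS leq_subr.
rewrite (_ : (N + N - (N + N - k) = k)%N); last by lia.
have [le_Nk|//] := leqP.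
by rewrite (_ : k = N) ?addnK //; lia.
Qed.

(** Since the border of D vanishes, both sums in [diagonal_sum_telescope] may stop before N, and 1 -
    w z factors out. *)
Lemma diagonal_sum_quotient (a : C) (M : nat -> nat -> C) N w z : a != 0 ->
    almost (fun x => \sum_(k < N.+1) \sum_(l < N.+1)
       M k l * cayley (- a) x ^+ k * cayley a x ^+ l = 0) ->
  \sum_(k < N.+1) \sum_(l < N.+1) M k l * w ^+ k * z ^+ l
    = (1 - w * z) * \sum_(k < N) \sum_(l < N) diagonal_sum M k l * w ^+ k * z ^+ l.
Proof.
move=> nz_a /(diagonal_sum_eq0 nz_a) D0; rewrite diagonal_sum_telescope mulrBl mul1r.
congr (_ - _); apply/eqP; rewrite -subr_eq0.
rewrite (border_sum _ (fun k l => diagonal_sum M k l * w ^+ k * z ^+ l)) !big1 ?addr0 //.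
  by move=> l _; rewrite (proj1 (D0 l _)) ?mul0r // -ltnS.
by move=> k _; rewrite (proj2 (D0 k _)) ?mul0r // ltnW.
Qed.

Lemma matrix_divmod (R : pzRingType) m N p q (X : 'M[R]_(m * N, p * q)) :
  exists f : nat -> nat -> nat -> nat -> R, forall K L,
    X K L = f (K %/ m)%N (K %% m)%N (L %/ p)%N (L %% p)%N.
Proof.
exists (fun i j k l => if insub (i * m + j)%N is Some K then
  if insub (k * p + l)%N is Some L then X K L else 0 else 0) => K L.
by rewrite -!divn_eq !valK.
Qed.

(** With the second variables outermost, the form is a polynomial in w2 and z2 whose coefficients,
    polynomials in w1 and z1, can be divided by 1 - w1 z1 separately. *)
Lemma vander_formE m N (X : 'M[C]_(m * N)) f w1 w2 z1 z2 :
    (forall K L, X K L = f (K %/ m)%N (K %% m)%N (L %/ m)%N (L %% m)%N) ->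
  ((vander m N w1 w2)^T *m X *m vander m N z1 z2) 0 0
    = \sum_(i < m) (\sum_(j < m)
        (\sum_(k < N) \sum_(l < N) f k i l j * w1 ^+ k * z1 ^+ l) * z2 ^+ j) * w2 ^+ i.
Proof.
move=> Xf.
transitivity (\sum_(k < N) \sum_(i < m) \sum_(l < N) \sum_(j < m)
    f k i l j * (w1 ^+ k * w2 ^+ i) * (z1 ^+ l * z2 ^+ j)).
  rewrite -(sum_divmod m N (fun k i => \sum_(l < N) \sum_(j < m)
      f k i l j * (w1 ^+ k * w2 ^+ i) * (z1 ^+ l * z2 ^+ j))).
  rewrite -mulmxA mxE; apply: eq_bigr => K _.
  rewrite -(sum_divmod m N (fun l j => f (K %/ m)%N (K %% m)%N l j
     * (w1 ^+ (K %/ m)%N * w2 ^+ (K %% m)%N) * (z1 ^+ l * z2 ^+ j))).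
  rewrite !mxE mulr_sumr; apply: eq_bigr => L _; rewrite !mxE Xf; ring.
rewrite exchange_big; apply: eq_bigr => i _ /=.
rewrite mulr_suml; under [RHS]eq_bigr do rewrite mulr_suml mulr_suml.
rewrite [RHS]exchange_big /=; apply: eq_bigr => k _.
rewrite exchange_big; apply: eq_bigr => j _ /=.
by rewrite !mulr_suml; apply: eq_bigr => l _; ring.
Qed.

Lemma displacement_quotient m N a (X : 'M[C]_(m * N.+1)) : a != 0 ->
    almost (fun x => almost (fun m2 => almost (fun l2 =>
      ((vander m N.+1 (cayley (- a) x) (cayley (- a) m2))^T *m X
         *m vander m N.+1 (cayley a x) (cayley a l2)) 0 0 = 0))) ->
  exists R : 'M[C]_(m * N), forall w1 w2 z1 z2,
    ((vander m N.+1 w1 w2)^T *m X *m vander m N.+1 z1 z2) 0 0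
      = (1 - w1 * z1) * ((vander m N w1 w2)^T *m R *m vander m N z1 z2) 0 0.
Proof.
move=> nz_a X0; have [f Xf] := matrix_divmod X.
pose D i j k l := diagonal_sum (fun k l => f k i l j) k l.
exists (\matrix_(K, L) D (K %% m)%N (L %% m)%N (K %/ m)%N (L %/ m)%N) => w1 w2 z1 z2.
rewrite (vander_formE w1 w2 z1 z2 Xf).
rewrite (@vander_formE _ _ _ (fun k i l j => D i j k l)) => [|K L]; last by rewrite mxE.
rewrite mulr_sumr; apply: eq_bigr => i _; rewrite mulrA; congr (_ * _).
rewrite mulr_sumr; apply: eq_bigr => j _; rewrite mulrA; congr (_ * _).
apply: (diagonal_sum_quotient (a := a)) => //; apply: almost_imp X0 => x X0.
(* [S i j] is the coefficient of w2^i z2^j at a point of w1 z1 = 1. As m2 and l2 are free, the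
   powers of w2 are separated first, then those of z2, in the reverse order of reading. *)
pose S i j := \sum_(k < N.+1) \sum_(l < N.+1)
  f k i l j * cayley (- a) x ^+ k * cayley a x ^+ l.
suffices S0 : \poly_(i < m) S i j = 0.
  by have := coef_poly m (fun i => S i j) i; rewrite S0 coef0 ltn_ord.
apply: (@almost_cayley_eq0 _ (- a)); first by rewrite oppr_eq0.
apply: almost_imp X0 => m2 X0; rewrite horner_poly.
suffices T0 : \poly_(j < m) (\sum_(i < m) S i j * cayley (- a) m2 ^+ i) = 0.
  have := coef_poly m (fun j => \sum_(i < m) S i j * cayley (- a) m2 ^+ i) j.
  by rewrite T0 coef0 ltn_ord.
apply: (almost_cayley_eq0 nz_a); apply: almost_imp X0 => l2.
rewrite (vander_formE _ _ _ _ Xf) horner_poly => X0; rewrite -[RHS]X0.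
under eq_bigr do rewrite mulr_suml.
rewrite exchange_big; apply: eq_bigr => i' _ /=; rewrite mulr_suml.
by apply: eq_bigr => j' _; rewrite -/(S i' j'); ring.
Qed.

End Bezout.

(** * The function omega *)

Section Resolvents.
Variable C : numClosedFieldType.
Local Notation a := ('i / 2%:R : C).

Lemma imag_half_neq0 : a != 0.
Proof. by rewrite mulf_neq0 ?invr_eq0 ?pnatr_eq0 ?neq0Ci. Qed.

(* (calA - l I) applied to the vector of powers of z = (l + a) / (l - a) is the
   constant vector a - l. *)
Lemma acoef_sum N (i : nat) (l : C) : (i < N)%N -> l != a ->
  \sum_(k < N) acoef C (i%:Z - k%:Z) * cayley a l ^+ k - l * cayley a l ^+ i = a - l.
Proof.
move=> lt_iN ne_la; set z := cayley a l.
rewrite -(big_mkord xpredT (fun k => acoef C (i%:Z - k%:Z) * z ^+ k)).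
rewrite (big_cat_nat _ (ltnW lt_iN)) //= big_mkord (big_ltn lt_iN).
rewrite [X in _ + (_ + X)]big_nat [X in _ + (_ + X)]big1 => [|k /andP[lt_ik _]]; last first.
  by rewrite /acoef (_ : (i%:Z - k%:Z < 0) = true) ?mul0r //; lia.
rewrite addr0 {2}/acoef subrr ltxx eqxx.
have -> : \sum_(k < i) acoef C (i%:Z - k%:Z) * z ^+ k = 'i * \sum_(k < i) z ^+ k.
  rewrite mulr_sumr; apply: eq_bigr => k _; rewrite /acoef.
  rewrite (_ : (i%:Z - k%:Z < 0) = false); last by have := ltn_ord k; lia.
  by rewrite (_ : (i%:Z - k%:Z == 0) = false) //; have := ltn_ord k; lia.
have nz_la : l - a != 0 by rewrite subr_eq0.
(* z - 1 = 2a / (l - a) and 2a = i; this sums the geometric series. *)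
have Ei : 'i = (l - a) * (z - 1) :> C.
  by rewrite mulrBr mulr1 [_ * z]mulrC divfK //; field.
rewrite {1}Ei -mulrA -subrX1; ring.
Qed.

Lemma A1_sub_mul m n (z2 l : C) : l != a ->
  (A1 C m n - l%:M) *m vander m n (cayley a l) z2 = (a - l) *: vander m n 1 z2.
Proof.
move=> ne_la; apply/matrixP=> K j; rewrite mulmxBl mul_scalar_mx [LHS]mxE.
rewrite [X in X + _]mxE [X in _ + X]mxE [X in - X]mxE !mxE expr1n mul1r.
have [m_gt0 lt_Kn] := ord_divn_lt K.
have lt_Km : (K %% m < m)%N by rewrite ltn_mod.
rewrite -(acoef_sum lt_Kn ne_la) mulrBl mulrA; congr (_ - _).
transitivity (\sum_(i < n) \sum_(k < m) acoef C ((K %/ m)%N%:Z - i%:Z)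
   * (((K %% m)%N == k)%:R) * (cayley a l ^+ i * z2 ^+ k)).
  rewrite -(sum_divmod m n (fun i k => acoef C ((K %/ m)%N%:Z - i%:Z)
   * (((K %% m)%N == k)%:R) * (cayley a l ^+ i * z2 ^+ k))).
  by apply: eq_bigr => L _; rewrite !mxE.
rewrite mulr_suml; apply: eq_bigr => i _.
rewrite (bigD1 (Ordinal lt_Km)) //= eqxx big1 ?addr0 => [|k ne_k].
  by rewrite mulr1 mulrA.
by rewrite eq_sym (negPf (ne_k : (k : nat) != _)) mulr0 mul0r.
Qed.

Lemma A2_sub_mul m n (z1 l : C) : l != a ->
  (A2 C m n - l%:M) *m vander m n z1 (cayley a l) = (a - l) *: vander m n z1 1.
Proof.
move=> ne_la; apply/matrixP=> K j; rewrite mulmxBl mul_scalar_mx [LHS]mxE.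
rewrite [X in X + _]mxE [X in _ + X]mxE [X in - X]mxE !mxE expr1n mulr1.
have [m_gt0 lt_Kn] := ord_divn_lt K.
have lt_Km : (K %% m < m)%N by rewrite ltn_mod.
rewrite -(acoef_sum lt_Km ne_la) mulrBl [l * (_ * _)]mulrCA [X in _ = _ - X]mulrC.
congr (_ - _).
transitivity (\sum_(i < n) \sum_(k < m) (((K %/ m)%N == i)%:R)
   * acoef C ((K %% m)%N%:Z - k%:Z) * (z1 ^+ i * cayley a l ^+ k)).
  rewrite -(sum_divmod m n (fun i k => (((K %/ m)%N == i)%:R)
   * acoef C ((K %% m)%N%:Z - k%:Z) * (z1 ^+ i * cayley a l ^+ k))).
  by apply: eq_bigr => L _; rewrite !mxE.
rewrite (bigD1 (Ordinal lt_Kn)) //= eqxx [X in _ + X]big1 ?addr0 => [|i ne_i].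
  by rewrite mulr_suml; apply: eq_bigr => k _; rewrite mul1r; ring.
rewrite big1 // => k _.
by rewrite eq_sym (negPf (ne_i : (i : nat) != _)) !mul0r.
Qed.

(** The matrix is lower triangular with constant diagonal a - l. *)
Lemma A1_sub_unit m n (l : C) : l != a -> A1 C m n - l%:M \in unitmx.
Proof.
move=> ne_la; rewrite unitmxE det_trig; last first.
  apply/is_trig_mxP=> K L lt_KL; rewrite !mxE.
  have ne_KL : (K == L) = false by apply/negbTE; rewrite -val_eqE ltn_eqF.
  rewrite ne_KL mulr0n subr0 /acoef.
  have le_div := leq_div2r m (ltnW lt_KL).
  have [eq_mod|] := eqVneq (K %% m)%N (L %% m)%N; last by rewrite mulr0.
  have ne_div : (K %/ m)%N != (L %/ m)%N.
    apply: contraTneq lt_KL => eq_div.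
    by rewrite (divn_eq K m) (divn_eq L m) eq_div eq_mod ltnn.
  by rewrite (_ : (_ < 0) = true) ?mul0r //; lia.
rewrite unitfE; apply/prodf_neq0 => K _.
by rewrite !mxE !eqxx mulr1 mulr1n /acoef subrr ltxx eqxx subr_eq0 eq_sym.
Qed.

Lemma A2_sub_unit m n (l : C) : l != a -> A2 C m n - l%:M \in unitmx.
Proof.
move=> ne_la; rewrite unitmxE det_trig; last first.
  apply/is_trig_mxP=> K L lt_KL; rewrite !mxE.
  have ne_KL : (K == L) = false by apply/negbTE; rewrite -val_eqE ltn_eqF.
  rewrite ne_KL mulr0n subr0 /acoef.
  have [eq_div|] := eqVneq (K %/ m)%N (L %/ m)%N; last by rewrite mul0r.
  have lt_mod : (K %% m < L %% m)%N.
    by move: lt_KL; rewrite {1}(divn_eq K m) {1}(divn_eq L m) eq_div ltn_add2l.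
  by rewrite (_ : (_ < 0) = true) ?mulr0 //; lia.
rewrite unitfE; apply/prodf_neq0 => K _.
by rewrite !mxE !eqxx mul1r mulr1n /acoef subrr ltxx eqxx subr_eq0 eq_sym.
Qed.

(** The all-ones vector is the monomial vector at (1, 1); [A1_sub_mul] and [A2_sub_mul] turn one 1
    after the other into a Cayley variable. *)
Lemma resolvent_vander m n (l1 l2 : C) : l1 != a -> l2 != a ->
  invmx (A2 C m n - l2%:M) *m invmx (A1 C m n - l1%:M) *m const_mx 1
    = ((l1 - a)^-1 * (l2 - a)^-1) *: vander m n (cayley a l1) (cayley a l2).
Proof.
move=> ne1 ne2; have nz1 : a - l1 != 0 by rewrite subr_eq0 eq_sym.
have nz2 : a - l2 != 0 by rewrite subr_eq0 eq_sym.
have -> : const_mx 1 = vander m n 1 1 :> 'cV[C]_(m * n).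
  by apply/matrixP=> K j; rewrite !mxE !expr1n mulr1.
have E1 := congr1 (mulmx (invmx (A1 C m n - l1%:M))) (A1_sub_mul m n 1 ne1).
rewrite mulKmx ?A1_sub_unit // -scalemxAr in E1.
have E2 := congr1 (mulmx (invmx (A2 C m n - l2%:M))) (A2_sub_mul m n (cayley a l1) ne2).
rewrite mulKmx ?A2_sub_unit // -scalemxAr in E2.
rewrite -mulmxA -[invmx _ *m vander _ _ _ _](scalerK nz1) -E1 -scalemxAr.
rewrite -[_ *m vander _ _ _ _](scalerK nz2) -E2 !scalerA.
by rewrite -[l1 - a]opprB -[l2 - a]opprB !invrN mulrNN.
Qed.

Lemma ctr_mul p q r (A : 'M[C]_(p, q)) (B : 'M[C]_(q, r)) :
  ctr (A *m B) = ctr B *m ctr A.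
Proof. by rewrite /ctr trmx_mul map_mxM. Qed.

Lemma ctr_inv p (A : 'M[C]_p) : ctr (invmx A) = invmx (ctr A).
Proof. by rewrite /ctr trmx_inv map_invmx. Qed.

Lemma ctr_sub_scalar p (A : 'M[C]_p) (l : C) : ctr (A - (l^*)%:M) = ctr A - l%:M.
Proof.
by rewrite /ctr linearB /= map_mxB tr_scalar_mx map_scalar_mx /= conjCK.
Qed.

Lemma conj_imag_half : a^* = - a.
Proof. by rewrite fmorph_div /= conjCi rmorph_nat mulNr. Qed.

Lemma conj_inv_sub (l : C) : ((l^* - a)^-1)^* = (l + a)^-1.
Proof. by rewrite fmorphV rmorphB /= conjCK conj_imag_half opprK. Qed.

Lemma conj_cayley (l : C) : (cayley a (l^*))^* = cayley (- a) l.
Proof. by rewrite rmorphM /= conj_inv_sub rmorphD /= conjCK conj_imag_half /cayley opprK. Qed.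

(** Conjugate transpose of [resolvent_vander] at the conjugate points; conjugation sends a to -a. *)
Lemma resolvent_ctr_vander m n (m1 m2 : C) : m1 != - a -> m2 != - a ->
  const_mx 1 *m invmx (ctr (A1 C m n) - m1%:M) *m invmx (ctr (A2 C m n) - m2%:M)
    = ((m1 + a)^-1 * (m2 + a)^-1) *: (vander m n (cayley (- a) m1) (cayley (- a) m2))^T.
Proof.
move=> ne1 ne2.
have ne_conj l : l != - a -> l^* != a.
  by apply: contraNneq => /(congr1 Num.conj); rewrite conjCK conj_imag_half => ->.
have := congr1 (@ctr C _ _) (resolvent_vander m n (ne_conj _ ne1) (ne_conj _ ne2)).
rewrite !ctr_mul !ctr_inv !ctr_sub_scalar mulmxA.
have -> : ctr (const_mx 1 : 'cV[C]_(m * n)) = const_mx 1.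
  by apply/matrixP=> i j; rewrite !mxE rmorph1.
move=> ->; rewrite /ctr; apply/matrixP=> i j; rewrite !mxE.
by rewrite rmorphM [in LHS]rmorphM rmorphM !rmorphXn /= !conj_inv_sub !conj_cayley.
Qed.

Lemma omega_rhsE m n (R : 'M[C]_(m * n)) (l1 l2 m1 m2 : C) :
    l1 != a -> l2 != a -> m1 != - a -> m2 != - a ->
  omega_rhs R l1 l2 m1 m2
    = (l1 - a)^-1 * (l2 - a)^-1 * (m1 + a)^-1 * (m2 + a)^-1
      * ((vander m n (cayley (- a) m1) (cayley (- a) m2))^T *m R
           *m vander m n (cayley a l1) (cayley a l2)) 0 0.
Proof.
move=> nl1 nl2 nm1 nm2; rewrite /omega_rhs resolvent_ctr_vander //.
rewrite -mulmxA -mulmxA [invmx _ *m (_ *m _)]mulmxA.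
rewrite resolvent_vander // -!scalemxAl -scalemxAr [LHS]mxE [X in _ * X]mxE.
by ring.
Qed.

End Resolvents.

(** * Exchanging the two levels of blocks *)

Section SwapIndices.
Variable C : numClosedFieldType.

Fact swap_ord_subproof m n (K : 'I_(n * m)) : (K %% n * m + K %/ n < m * n)%N.
Proof.
have [n_gt0 lt_div] := ord_divn_lt K.
have lt_mod : (K %% n < n)%N by rewrite ltn_mod.
have : ((K %% n).+1 * m <= n * m)%N by rewrite leq_mul2r lt_mod orbT.
rewrite mulSn; lia.
Qed.

Definition swap_ord m n (K : 'I_(n * m)) : 'I_(m * n) := Ordinal (swap_ord_subproof K).

Lemma swap_ord_div m n (K : 'I_(n * m)) :
  (swap_ord K %/ m = K %% n)%N /\ (swap_ord K %% m = K %/ n)%N.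
Proof.
have [n_gt0 lt_div] := ord_divn_lt K.
have m_gt0 : (0 < m)%N by apply: leq_ltn_trans lt_div.
by rewrite /= divnMDl // modnMDl (modn_small lt_div) (divn_small lt_div) addn0.
Qed.

Lemma swap_ordK m n : cancel (@swap_ord m n) (@swap_ord n m).
Proof.
move=> K; have [div_s mod_s] := swap_ord_div K.
by apply: val_inj; rewrite /= div_s mod_s -divn_eq.
Qed.

Definition swap_mx m n : 'M[C]_(n * m, m * n) := sel C (@swap_ord m n).

Lemma swap_mxK m n : swap_mx m n *m swap_mx n m = 1%:M.
Proof. by apply/matrixP=> K L; rewrite mul_selE !mxE swap_ordK. Qed.

Lemma tr_swap_mx m n : (swap_mx m n)^T = swap_mx n m.
Proof.
by apply/matrixP=> K L; rewrite !mxE (can2_eq (@swap_ordK _ _) (@swap_ordK _ _)) eq_sym.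
Qed.

Lemma swap_vander m n (x1 x2 : C) :
  swap_mx m n *m vander m n x1 x2 = vander n m x2 x1.
Proof.
apply/matrixP=> K j; rewrite mul_selE !mxE.
by have [-> ->] := swap_ord_div K; rewrite mulrC.
Qed.

(** The second variables become the block variables, so results on the outer shift apply to the
    inner one. *)
Definition swap_blocks m n (R : 'M[C]_(m * n)) : 'M[C]_(n * m) :=
  swap_mx m n *m R *m swap_mx n m.

Lemma swap_blocks_mul m n (R T : 'M[C]_(m * n)) :
  R *m T = 1%:M -> swap_blocks R *m swap_blocks T = 1%:M.
Proof.
move=> RT; rewrite /swap_blocks -!mulmxA [swap_mx n m *m (_ *m _)]mulmxA swap_mxK.
by rewrite mul1mx [R *m _]mulmxA RT mul1mx swap_mxK.
Qed.

Lemma swap_blocks_form m n (R : 'M[C]_(m * n)) w1 w2 z1 z2 :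
  ((vander n m w2 w1)^T *m swap_blocks R *m vander n m z2 z1) 0 0
    = ((vander m n w1 w2)^T *m R *m vander m n z1 z2) 0 0.
Proof.
rewrite -(swap_vander m n z1) -(swap_vander m n w1) /swap_blocks trmx_mul tr_swap_mx -!mulmxA.
rewrite [swap_mx n m *m (swap_mx m n *m _)]mulmxA swap_mxK mul1mx.
by rewrite [swap_mx n m *m (swap_mx m n *m _)]mulmxA swap_mxK mul1mx.
Qed.

Lemma swap_blocksE m n (T : 'M[C]_(m * n)) K L :
  swap_blocks T K L = T (swap_ord K) (swap_ord L).
Proof. by rewrite /swap_blocks -[swap_mx n m]tr_swap_mx mulmx_tr_selE mul_selE. Qed.

(** Both indices are lowered until one is 0; truncated subtraction records the result. *)
Lemma shift_reduce (T : Type) (g : nat -> nat -> T) n :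
    (forall i k, (i < n)%N -> (k < n)%N -> g i.+1 k.+1 = g i k) ->
  forall i k, (i <= n)%N -> (k <= n)%N -> g i k = g (i - k)%N (k - i)%N.
Proof.
move=> gS; elim=> [|i IHi] [|k] // le_i le_k.
by rewrite gS // IHi ?subSS // ltnW.
Qed.

Lemma ord_divmod m n i j : (i < n)%N -> (j < m)%N ->
  exists2 K : 'I_(m * n), (K %/ m)%N = i & (K %% m)%N = j.
Proof.
move=> lt_i lt_j; have m_gt0 : (0 < m)%N by apply: leq_ltn_trans lt_j.
have ltK : (i * m + j < m * n)%N.
  have : (i.+1 * m <= n * m)%N by rewrite leq_mul2r lt_i orbT.
  by rewrite mulSn; lia.
exists (Ordinal ltK) => /=; first by rewrite divnMDl // divn_small ?addn0.
by rewrite modnMDl modn_small.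
Qed.

Lemma hi_div m n (K : 'I_(m.+1 * n)) :
  (hi K %/ m.+1 = (K %/ m.+1).+1)%N /\ (hi K %% m.+1 = K %% m.+1)%N.
Proof. by rewrite /= divnDl ?dvdnn // divnn add1n modnDl. Qed.

Definition posz_part (r : int) : nat := if r is Posz k then k else 0%N.

Lemma posz_part_sub (i k : nat) : posz_part (i%:Z - k%:Z) = (i - k)%N.
Proof.
have [le_ki|lt_ik] := leqP k i; first by rewrite subzn.
by rewrite -opprB subzn ?(ltnW lt_ik) // -[in LHS](prednK (_ : 0 < k - i)%N) ?subn_gt0 //;
   have /eqP -> := ltnW lt_ik.
Qed.

Lemma toeplitz_block_toeplitz_shift m n (T : 'M[C]_(m.+1 * n.+1)) :
    (forall P Q : 'I_(m.+1 * n), T (hi P) (hi Q) = T (lo P) (lo Q)) ->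
    (forall P Q : 'I_(n.+1 * m),
       swap_blocks T (hi P) (hi Q) = swap_blocks T (lo P) (lo Q)) ->
  toeplitz_block_toeplitz T.
Proof.
move=> outerT innerT; have [f Tf] := matrix_divmod T.
have f_outer i j k l : (i < n)%N -> (k < n)%N -> (j <= m)%N -> (l <= m)%N ->
    f i.+1 j k.+1 l = f i j k l.
  move=> lt_i lt_k lt_j lt_l.
  have [K <- <-] := ord_divmod lt_i (lt_j : (j < m.+1)%N).
  have [L <- <-] := ord_divmod lt_k (lt_l : (l < m.+1)%N).
  have := outerT K L; rewrite !Tf; have [-> ->] := hi_div K.
  by have [-> ->] := hi_div L.
have f_inner i j k l : (j < m)%N -> (l < m)%N -> (i <= n)%N -> (k <= n)%N ->
    f i j.+1 k l.+1 = f i j k l.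
  move=> lt_j lt_l lt_i lt_k.
  have [K <- <-] := ord_divmod lt_j (lt_i : (i < n.+1)%N).
  have [L <- <-] := ord_divmod lt_l (lt_k : (k < n.+1)%N).
  have := innerT K L; rewrite !swap_blocksE !Tf.
  have [-> ->] := swap_ord_div (hi K); have [-> ->] := swap_ord_div (hi L).
  have [-> ->] := swap_ord_div (lo K); have [-> ->] := swap_ord_div (lo L).
  have [-> ->] := hi_div K; have [-> ->] := hi_div L.
  by rewrite /=.
(* The entry is read where one block index and one inner index are 0: the row indices are the
   positive parts of r and s, the column indices their negative parts. *)
exists (fun r s => f (posz_part r) (posz_part s) (posz_part (- r)) (posz_part (- s))).
move=> K L; rewrite Tf !opprB !posz_part_sub.
have lt_div (X : 'I_(m.+1 * n.+1)) : (X %/ m.+1 <= n)%N by case: (ord_divn_lt X).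
have lt_mod (X : nat) : (X %% m.+1 <= m)%N by rewrite -ltnS ltn_mod.
rewrite (shift_reduce (g := fun i k => f i _ k _)
  (fun i k lt_i lt_k => f_outer i _ k _ lt_i lt_k (lt_mod K) (lt_mod L))) //.
apply: (shift_reduce (g := fun j l => f _ j _ l) (n := m)) => // j l lt_j lt_l.
by apply: f_inner => //; apply: leq_trans (leq_subr _ _) _.
Qed.

End SwapIndices.

(** * Omega as a rational function of the Cayley variables *)

Section CoefficientMatrix.
Variables (C : numClosedFieldType) (b : C) (m n p : nat).
Variable V : 'cV[{poly {poly C}}]_p.

Definition coef_mx : 'M[C]_(p, m * n.+1) := \matrix_(i, K) expansion b m n (V i 0) 0 K.

Lemma coef_mxE l1 l2 : b != 0 -> (0 < m)%N ->
    (forall i, (size (V i 0%R) <= n.+1)%N /\ (sizeY (V i 0%R) <= m)%N) ->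
    l1 != b -> l2 != b ->
  coef_mx *m vander m n.+1 (cayley b l1) (cayley b l2)
    = ((l1 - b) ^+ n * (l2 - b) ^+ m.-1)^-1 *: map_mx (bieval l1 l2) V.
Proof.
move=> nz_b m_gt0 szV ne1 ne2; apply/matrixP=> i j; rewrite (ord1 j).
have [szVi szYVi] := szV i.
rewrite [RHS]mxE [X in _ * X]mxE mulrC /bieval -expansionE // [LHS]mxE [RHS]mxE.
by apply: eq_bigr => K _; rewrite [X in X * _]mxE.
Qed.

End CoefficientMatrix.

Section Omega.
Variables (C : numClosedFieldType) (m n : nat) (hm : (0 < m)%N) (hn : (0 < n)%N).
Variables (g12 : 'M[C]_(m + m, n + n)) (g21 : 'M[C]_(n + n, m + m)).
Hypothesis g21E : g21 = - (Umx C n *m Jmx C n *m g12^T *m Jmx C m *m Umx C m).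
Variable theta : {poly {poly C}}.
Hypothesis theta_sq : forall l1 l2 : C, peval2 theta l1 l2 ^+ 2 = \det (Gmx g12 g21 l1 l2).
Variable Q : 'cV[{poly {poly C}}]_((m + m) + (n + n)).
Hypothesis GQ : forall l1 l2, Gmx g12 g21 l1 l2 *m map_mx (bieval l1 l2) Q
                              = bieval l1 l2 theta *: rhsvec C m n.
Local Notation a := ('i / 2%:R : C).
Local Notation Qat l1 l2 := (map_mx (bieval l1 l2) Q).
Local Notation S := (Smx C m n).

Lemma det_neq0 l1 l2 : (\det (Gmx g12 g21 l1 l2) != 0) = (bieval l1 l2 theta != 0).
Proof. by rewrite -theta_sq peval2E sqrf_eq0. Qed.

Lemma uhatE l1 l2 : bieval l1 l2 theta != 0 ->
  uhat g12 g21 theta l1 l2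
    = (- 'i * (l1 - a) ^- n * (l2 - a) ^- m) *: Qat l1 l2.
Proof.
move=> nz_t; have uG : Gmx g12 g21 l1 l2 \in unitmx.
  by rewrite unitmxE unitfE det_neq0.
by rewrite /uhat peval2E -scalerA scalemxAr -GQ mulKmx.
Qed.

(** Up to scalar factors, [pairing1] and [pairing2] are u(mu) P_1 uhat(lambda) and u(mu) P_2
    uhat(lambda). *)
Definition pairing1 l1 l2 m1 m2 : C :=
  ((usubmx (Qat m1 m2))^T *m sym_mx C m *m usubmx (Qat l1 l2)) 0 0.

Definition pairing2 l1 l2 m1 m2 : C :=
  ((dsubmx (Qat m1 m2))^T *m sym_mx C n *m dsubmx (Qat l1 l2)) 0 0.

Lemma skew_form_eq0 p (X : 'M[C]_p) (v : 'cV_p) : X^T = - X -> (v^T *m X *m v) 0 0 = 0.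
Proof.
move=> skewX; set c := (_ *m v) 0 0.
have : c = - c.
  rewrite {1}/c -[v^T *m X *m v]trmxK mxE !trmx_mul trmxK skewX mulNmx mulmxN mulmxA.
  by rewrite mxE.
by move/eqP; rewrite -addr_eq0 -mulr2n mulrn_eq0 /= => /eqP.
Qed.

Lemma Smx_Gmx_skew l1 l2 :
  (S *m Gmx g12 g21 l1 l2)^T = - (S *m Gmx g12 g21 l1 l2).
Proof. by rewrite trmx_mul tr_Smx mulmxN -Smx_Gmx. Qed.

(** Q^T S G Q vanishes because S G is skew-symmetric, and it equals theta Q^T S r. *)
Lemma rhs_isotropic l1 l2 : bieval l1 l2 theta != 0 ->
  ((Qat l1 l2)^T *m S *m rhsvec C m n) 0 0 = 0.
Proof.
move=> nz_t; apply: (mulfI nz_t); rewrite mulr0.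
have := skew_form_eq0 (Qat l1 l2) (Smx_Gmx_skew l1 l2).
by rewrite -!mulmxA GQ -!scalemxAr mxE.
Qed.

Lemma rhs_isotropic_tr l1 l2 : bieval l1 l2 theta != 0 ->
  ((rhsvec C m n)^T *m S *m Qat l1 l2) 0 0 = 0.
Proof.
move=> /rhs_isotropic H; rewrite -[_ *m _ *m _]trmxK mxE !trmx_mul trmxK tr_Smx.
by rewrite mulNmx mulmxN mulmxA mxE H oppr0.
Qed.

(** Q(mu)^T S G(lambda) Q(lambda) and Q(mu)^T S G(mu) Q(lambda) both vanish by isotropy of r, and
    G(lambda) - G(mu) is diagonal with one scalar on each block. *)
Lemma pairing_relation l1 l2 m1 m2 :
    bieval l1 l2 theta != 0 -> bieval m1 m2 theta != 0 ->
  (l2 - m2) * pairing1 l1 l2 m1 m2 = (l1 - m1) * pairing2 l1 l2 m1 m2.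
Proof.
move=> nz_l nz_m; set p := Qat m1 m2; set q := Qat l1 l2.
have pGlq : (p^T *m S *m (Gmx g12 g21 l1 l2 *m q)) 0 0 = 0.
  by rewrite GQ -scalemxAr mxE rhs_isotropic ?mulr0.
have pGmq : (p^T *m S *m (Gmx g12 g21 m1 m2 *m q)) 0 0 = 0.
  rewrite mulmxA -[p^T *m S *m _]mulmxA Smx_Gmx // mulmxA -trmx_mul GQ.
  by rewrite linearZ /= -!scalemxAl mxE rhs_isotropic_tr ?mulr0.
have diffG : Gmx g12 g21 l1 l2 - Gmx g12 g21 m1 m2
    = - block_mx ((l2 - m2)%:M) 0 0 ((l1 - m1)%:M).
  rewrite (GmxE _ _ l1) (GmxE _ _ m1) opprB addrC addrA subrK -opprB; congr (- _).
  by rewrite opp_block_mx add_block_mx !raddfB /= !oppr0 !addr0.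
have : (p^T *m S *m ((Gmx g12 g21 l1 l2 - Gmx g12 g21 m1 m2) *m q)) 0 0 = 0.
  by rewrite mulmxBl mulmxBr mxE pGlq [X in _ + X]mxE pGmq subr0.
rewrite diffG -{1}[p]vsubmxK -{1}[q]vsubmxK mulNmx mul_block_col !mul0mx addr0 add0r.
rewrite tr_col_mx /Smx mul_row_block !mulmx0 addr0 add0r mulmxN mul_row_col.
rewrite !mul_scalar_mx -!scalemxAr mulmxN mulNmx scalerN.
rewrite mxE [X in - X]mxE [X in - (X + _)]mxE [X in - (_ + X)]mxE [X in - (_ - X)]mxE.
by rewrite -/(pairing1 l1 l2 m1 m2) -/(pairing2 l1 l2 m1 m2) => /eqP; rewrite oppr_eq0
   subr_eq0 => /eqP.
Qed.

Lemma omegaE l1 l2 m1 m2 : bieval l1 l2 theta != 0 -> bieval m1 m2 theta != 0 ->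
    m1 != a -> m2 != a ->
  omega g12 g21 theta l1 l2 m1 m2
    = - 'i * (l1 - m1)^-1 * (m1 + a) ^- n * (m2 + a) ^- m * (l1 - a) ^- n * (l2 - a) ^- m
      * pairing1 l1 l2 m1 m2.
Proof.
move=> nz_l nz_m ne1 ne2; rewrite /omega /ufun !uhatE //.
rewrite !Jmx_mul_Umx -{1}[Qat m1 m2]vsubmxK -[Qat l1 l2]vsubmxK.
rewrite [(_ *: _)^T]linearZ /= tr_col_mx -!scalemxAl -scalemxAr !scalerA.
rewrite mul_row_block !mulmx0 addr0 add0r /P1 mul_row_block !mulmx0 !mulmx1 !addr0.
rewrite mul_row_col mul0mx addr0 [X in _ * X]mxE -/(pairing1 l1 l2 m1 m2).
have nz1 : m1 - a != 0 by rewrite subr_eq0.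
have nz2 : m2 - a != 0 by rewrite subr_eq0.
(* One factor i comes from omega and one -i from each of uhat(lambda) and uhat(mu). *)
have iN : 'i * - 'i * - 'i = - 'i :> C by rewrite !mulrN mulNr opprK -expr2 sqrCi mulN1r.
rewrite -[in RHS]iN !expr_div_n.
have nz_u := expf_neq0 n nz1; have nz_v := expf_neq0 m nz2.
move: ((m1 - a) ^+ n) ((m2 - a) ^+ m) nz_u nz_v => u v nz_u nz_v.
move: ((m1 + a) ^+ n)^-1 ((m2 + a) ^+ m)^-1 => p q.
move: ((l1 - a) ^+ n)^-1 ((l2 - a) ^+ m)^-1 (l1 - m1)^-1 => r s t.
by field; rewrite nz_u nz_v.
Qed.

Hypothesis szQ1 : forall i,
  (size (Q (lshift _ i) 0%R) <= n.+1)%N /\ (sizeY (Q (lshift _ i) 0%R) <= m)%N.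
Hypothesis szQ2 : forall j,
  (size (Q (rshift _ j) 0%R) <= n)%N /\ (sizeY (Q (rshift _ j) 0%R) <= m.+1)%N.

Let nz_a : a != 0 := imag_half_neq0 C.

Let nz_aN : - a != 0.
Proof. by rewrite oppr_eq0. Qed.

(** [left_mx1^T *m right_mx1] is the coefficient matrix of N1, factored through dimension 2m. The
    second pair does the same for N2 through 2n, with variables exchanged because lambda_2 is then
    the block variable. *)
Definition left_mx1 := coef_mx (- a) m n (usubmx Q).
Definition right_mx1 := sym_mx C m *m coef_mx a m n (usubmx Q).
Definition left_mx2 := coef_mx (- a) n m (map_mx swapXY (dsubmx Q)).
Definition right_mx2 := sym_mx C n *m coef_mx a n m (map_mx swapXY (dsubmx Q)).

Lemma cayley_mul_sub (l k : C) : l != a -> k != - a ->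
  1 - cayley (- a) k * cayley a l = 'i * (l - k) / ((l - a) * (k + a)).
Proof.
move=> ne_l ne_k; rewrite /cayley opprK.
have nz_l : l - a != 0 by rewrite subr_eq0.
have nz_k : k + a != 0 by rewrite -[a]opprK subr_eq0.
have -> : 'i = 2%:R * a :> C by rewrite mulrC divfK ?pnatr_eq0.
by move: a nz_l nz_k => b nz_l nz_k; field; rewrite nz_l nz_k.
Qed.

Definition good l1 l2 m1 m2 : Prop :=
  [/\ [/\ bieval l1 l2 theta != 0, bieval m1 m2 theta != 0, l1 != m1 & l2 != m2],
      [/\ l1 != a & l2 != a], [/\ m1 != a & m2 != a] & [/\ m1 != - a & m2 != - a]].

Lemma pairing1_form l1 l2 m1 m2 : l1 != a -> l2 != a -> m1 != - a -> m2 != - a ->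
  ((vander m n.+1 (cayley (- a) m1) (cayley (- a) m2))^T *m (left_mx1^T *m right_mx1)
     *m vander m n.+1 (cayley a l1) (cayley a l2)) 0 0
   = ((m1 + a) ^+ n * (m2 + a) ^+ m.-1)^-1 * ((l1 - a) ^+ n * (l2 - a) ^+ m.-1)^-1
     * pairing1 l1 l2 m1 m2.
Proof.
move=> nl1 nl2 nm1 nm2.
have szU i : (size (usubmx Q i 0%R) <= n.+1)%N /\ (sizeY (usubmx Q i 0%R) <= m)%N.
  by rewrite mxE.
rewrite mulmxA -trmx_mul /right_mx1 mulmxA -[_ *m coef_mx _ _ _ _ *m _]mulmxA.
rewrite !coef_mxE // [(_ *: _)^T]linearZ /= -!scalemxAl -scalemxAr scalerA mxE !opprK.
by rewrite /pairing1 !map_usubmx.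
Qed.

Lemma pairing2_form l1 l2 m1 m2 : l1 != a -> l2 != a -> m1 != - a -> m2 != - a ->
  ((vander n m.+1 (cayley (- a) m2) (cayley (- a) m1))^T *m (left_mx2^T *m right_mx2)
     *m vander n m.+1 (cayley a l2) (cayley a l1)) 0 0
   = ((m2 + a) ^+ m * (m1 + a) ^+ n.-1)^-1 * ((l2 - a) ^+ m * (l1 - a) ^+ n.-1)^-1
     * pairing2 l1 l2 m1 m2.
Proof.
move=> nl1 nl2 nm1 nm2.
have szV i : (size (map_mx swapXY (dsubmx Q) i 0%R) <= m.+1)%N
          /\ (sizeY (map_mx swapXY (dsubmx Q) i 0%R) <= n)%N.
  by rewrite 2!mxE sizeYE swapXYK -sizeYE; case: (szQ2 i).
have swapE k1 k2 : map_mx (bieval k2 k1) (map_mx swapXY (dsubmx Q))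
                   = dsubmx (Qat k1 k2).
  by apply/matrixP=> i j; rewrite !mxE /bieval horner2_swapXY.
rewrite mulmxA -trmx_mul /right_mx2 mulmxA -[_ *m coef_mx _ _ _ _ *m _]mulmxA.
rewrite !coef_mxE // [(_ *: _)^T]linearZ /= -!scalemxAl -scalemxAr scalerA mxE !opprK.
by rewrite /pairing2 !swapE.
Qed.

Lemma omega_form1 (R : 'M[C]_(m * n)) l1 l2 m1 m2 :
    bieval l1 l2 theta != 0 -> bieval m1 m2 theta != 0 -> l1 != m1 ->
    l1 != a -> l2 != a -> m1 != a -> m2 != a -> m1 != - a -> m2 != - a ->
  omega g12 g21 theta l1 l2 m1 m2 = omega_rhs R l1 l2 m1 m2 <->
  (1 - cayley (- a) m1 * cayley a l1)
    * ((vander m n (cayley (- a) m1) (cayley (- a) m2))^T *m R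
         *m vander m n (cayley a l1) (cayley a l2)) 0 0
  = ((vander m n.+1 (cayley (- a) m1) (cayley (- a) m2))^T *m (left_mx1^T *m right_mx1)
     *m vander m n.+1 (cayley a l1) (cayley a l2)) 0 0.
Proof.
move=> tl tm ne1 nl1 nl2 nm1 nm2 nm1N nm2N.
rewrite omegaE // omega_rhsE // pairing1_form // cayley_mul_sub //.
(* The first block of Q has degree at most m - 1 in the second variable, whereas omega carries the
   exponent m: one power is split off. *)
rewrite -[in (m2 + a) ^- m](prednK hm) -[in (l2 - a) ^- m](prednK hm) !exprS.
set r := ((_)^T *m R *m _) 0 0; move: r (pairing1 _ _ _ _) => r f.
have nz1 : l1 - a != 0 by rewrite subr_eq0.
have nz2 : l2 - a != 0 by rewrite subr_eq0.
have nz3 : m1 + a != 0 by rewrite -[a]opprK subr_eq0.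
have nz4 : m2 + a != 0 by rewrite -[a]opprK subr_eq0.
have nz5 : l1 - m1 != 0 by rewrite subr_eq0.
have nzi : 'i != 0 :> C := neq0Ci C.
have := expf_neq0 n nz1; have := expf_neq0 m.-1 nz2.
have := expf_neq0 n nz3; have := expf_neq0 m.-1 nz4.
move: ((l1 - a) ^+ n) ((l2 - a) ^+ _) ((m1 + a) ^+ n) ((m2 + a) ^+ _) => p q s t.
move: (l1 - a) (l2 - a) (m1 + a) (m2 + a) (l1 - m1) nz1 nz2 nz3 nz4 nz5.
move=> d1 d2 d3 d4 d5 nz1 nz2 nz3 nz4 nz5 nz_t nz_s nz_q nz_p.
have nzX : ('i * d5 * d2 * d4)^-1 != 0 :> C by rewrite invr_neq0 ?mulf_neq0.
(* [- 'i] is written as the inverse of ['i], because [field] does not use i^2 = -1. *)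
rewrite -(invCi C).
transitivity (('i * d5 * d2 * d4)^-1 * ((s * t)^-1 * (p * q)^-1 * f)
              = ('i * d5 * d2 * d4)^-1 * ('i * d5 / (d1 * d3) * r)).
  have -> : 'i^-1 / d5 / s / (d4 * t) / p / (d2 * q) * f
          = ('i * d5 * d2 * d4)^-1 * ((s * t)^-1 * (p * q)^-1 * f).
    by field; rewrite ?nz_p ?nz_q ?nz_s ?nz_t ?nz4 ?nz2 ?nz5 ?nzi.
  have -> // : d1^-1 / d2 / d3 / d4 * r
          = ('i * d5 * d2 * d4)^-1 * ('i * d5 / (d1 * d3) * r).
  by field; rewrite nz1 nz2 nz3 nz4 nz5 nzi.
by split=> [/(mulfI nzX)|->].
Qed.

(** [pairing_relation] trades [pairing1] over lambda_1 - mu_1 for [pairing2] over lambda_2 - mu_2;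
    the rest is scalar bookkeeping. *)
Lemma omega_form2 (R : 'M[C]_(m * n)) l1 l2 m1 m2 :
    good l1 l2 m1 m2 ->
    omega g12 g21 theta l1 l2 m1 m2 = omega_rhs R l1 l2 m1 m2 ->
  (1 - cayley (- a) m2 * cayley a l2)
    * ((vander n m (cayley (- a) m2) (cayley (- a) m1))^T *m swap_blocks R
         *m vander n m (cayley a l2) (cayley a l1)) 0 0
  = ((vander n m.+1 (cayley (- a) m2) (cayley (- a) m1))^T *m (left_mx2^T *m right_mx2)
     *m vander n m.+1 (cayley a l2) (cayley a l1)) 0 0.
Proof.
move=> [[tl tm ne1 ne2] [nl1 nl2] [nm1 nm2] [nm1N nm2N]].
have rel := pairing_relation tl tm.
have nz5 : l1 - m1 != 0 by rewrite subr_eq0.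
have nz6 : l2 - m2 != 0 by rewrite subr_eq0.
have pairE : pairing1 l1 l2 m1 m2 = (l1 - m1) * pairing2 l1 l2 m1 m2 / (l2 - m2).
  by rewrite -rel mulrAC mulfV // mul1r.
rewrite omegaE // omega_rhsE // pairing2_form // cayley_mul_sub // pairE swap_blocks_form.
rewrite -[in (m1 + a) ^- n](prednK hn) -[in (l1 - a) ^- n](prednK hn) !exprS.
set r := ((_)^T *m R *m _) 0 0; move: r (pairing2 _ _ _ _) => r f.
have nz1 : l1 - a != 0 by rewrite subr_eq0.
have nz2 : l2 - a != 0 by rewrite subr_eq0.
have nz3 : m1 + a != 0 by rewrite -[a]opprK subr_eq0.
have nz4 : m2 + a != 0 by rewrite -[a]opprK subr_eq0.
have nzi : 'i != 0 :> C := neq0Ci C.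
have := expf_neq0 n.-1 nz1; have := expf_neq0 m nz2.
have := expf_neq0 n.-1 nz3; have := expf_neq0 m nz4.
move: ((l1 - a) ^+ _) ((l2 - a) ^+ m) ((m1 + a) ^+ _) ((m2 + a) ^+ m) => p q s t.
move: (l1 - a) (l2 - a) (m1 + a) (m2 + a) (l1 - m1) (l2 - m2) nz1 nz2 nz3 nz4 nz5 nz6.
move=> d1 d2 d3 d4 d5 d6 nz1 nz2 nz3 nz4 nz5 nz6 nz_t nz_s nz_q nz_p.
rewrite -(invCi C) => eq_omega.
transitivity ('i * d6 * d1 * d3 * (d1^-1 / d2 / d3 / d4 * r)).
  by field; rewrite ?nz1 ?nz2 ?nz3 ?nz4.
by rewrite -eq_omega; field; rewrite ?nz_p ?nz_q ?nz_s ?nz_t ?nz1 ?nz3 ?nz5 ?nz6 ?nzi.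
Qed.

End Omega.

(** * Generic points and the conclusion *)

Section Generic.
Variables (C : numClosedFieldType) (theta : {poly {poly C}}).
Hypothesis theta_neq0 : theta != 0.

Let almost_theta21 :
  almost (fun l2 => almost (fun l1 => bieval l1 l2 theta != 0)) :=
  almost_nonroot2 theta_neq0.

Let almost_theta12 :
  almost (fun l1 => almost (fun l2 => bieval l1 l2 theta != 0)).
Proof.
have := @almost_nonroot2 _ (swapXY theta).
rewrite swapXY_eq0 => /(_ theta_neq0); apply: almost_imp => l1; apply: almost_imp => l2.
by rewrite horner2_swapXY.
Qed.

(** The variables come in the order of [vander_form_eq0]; [almost_good12] has the order for
    exchanged levels. *)
Lemma almost_good21 :
  almost (fun m2 => almost (fun m1 => almost (fun l2 => almost (fun l1 =>
    good theta l1 l2 m1 m2)))).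
Proof.
have neqs (b c d : C) := almost_and (almost_neq b) (almost_and (almost_neq c) (almost_neq d)).
pose a : C := 'i / 2%:R.
apply: almost_imp (almost_and almost_theta21 (neqs a (- a) a)) => m2.
move=> [theta_m2 [? [? _]]].
apply: almost_imp (almost_and theta_m2 (neqs a (- a) a)) => m1 [? [? [? _]]].
apply: almost_imp (almost_and almost_theta21 (neqs a m2 a)) => l2 [theta_l2 [? [? _]]].
by apply: almost_imp (almost_and theta_l2 (neqs a m1 a)) => l1 [? [? [? _]]].
Qed.

Lemma almost_good12 :
  almost (fun m1 => almost (fun m2 => almost (fun l1 => almost (fun l2 =>
    good theta l1 l2 m1 m2)))).
Proof.
have neqs (b c d : C) := almost_and (almost_neq b) (almost_and (almost_neq c) (almost_neq d)).
pose a : C := 'i / 2%:R.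
apply: almost_imp (almost_and almost_theta12 (neqs a (- a) a)) => m1.
move=> [theta_m1 [? [? _]]].
apply: almost_imp (almost_and theta_m1 (neqs a (- a) a)) => m2 [? [? [? _]]].
apply: almost_imp (almost_and almost_theta12 (neqs a m1 a)) => l1 [theta_l1 [? [? _]]].
by apply: almost_imp (almost_and theta_l1 (neqs a m2 a)) => l2 [? [? [? _]]].
Qed.

(** Points with lambda_1 = mu_1 = x, where [pairing_relation] forces [pairing1] to vanish. *)
Lemma almost_vanish : almost (fun x => almost (fun m2 => almost (fun l2 =>
  [/\ bieval x l2 theta != 0, bieval x m2 theta != 0, l2 != m2 &
  [/\ x != 'i / 2%:R, l2 != 'i / 2%:R, x != - ('i / 2%:R) & m2 != - ('i / 2%:R)]]))).
Proof.
pose a : C := 'i / 2%:R.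
apply: almost_imp (almost_and almost_theta12
  (almost_and (almost_neq a) (almost_neq (- a)))) => x [theta_x [? ?]].
apply: almost_imp (almost_and theta_x (almost_neq (- a))) => m2 [? ?].
by apply: almost_imp (almost_and theta_x
  (almost_and (almost_neq m2) (almost_neq a))) => l2 [? [? ?]].
Qed.

End Generic.

Theorem theorem3p3 (C : numClosedFieldType) (m n : nat) (hm : (0 < m)%N) (hn : (0 < n)%N)
  (g12 : 'M[C]_(m + m, n + n)) (g21 : 'M[C]_(n + n, m + m))
  (hg21 : g21 = - (Umx C n *m Jmx C n *m g12^T *m Jmx C m *m Umx C m))
  (theta : {poly {poly C}})
  (htheta_sq : forall l1 l2 : C, peval2 theta l1 l2 ^+ 2 = \det (Gmx g12 g21 l1 l2))
  (htheta_lead : pcoef2 theta n m = -1) :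
  let dom l1 l2 m1 m2 :=
    [&& l1 != m1, l1 != 'i / 2%:R, l2 != 'i / 2%:R,
        m1 != 'i / 2%:R, m1 != - ('i / 2%:R), m2 != 'i / 2%:R, m2 != - ('i / 2%:R),
        \det (Gmx g12 g21 l1 l2) != 0 & \det (Gmx g12 g21 m1 m2) != 0] in
  let P (R : 'M[C]_(m * n)) := forall l1 l2 m1 m2 : C, dom l1 l2 m1 m2 ->
        omega g12 g21 theta l1 l2 m1 m2 = omega_rhs R l1 l2 m1 m2 in
  (exists! R : 'M[C]_(m * n), P R) /\
  (forall R : 'M[C]_(m * n), P R -> \det R != 0 -> @toeplitz_block_toeplitz C m n (invmx R)).
Proof.
case: m n hm hn g12 g21 hg21 htheta_sq htheta_lead => [//|m] [//|n] hm hn g12 g21.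
move=> hg21 htheta_sq htheta_lead dom P; have nz_theta : theta != 0.
  apply: contra_eq_neq htheta_lead => ->.
  by rewrite /pcoef2 !coef0 eq_sym oppr_eq0 oner_eq0.
have nz_a := imag_half_neq0 C.
have nz_aN : - ('i / 2%:R) != 0 :> C by rewrite oppr_eq0.
have [Q [GQ szQ1 szQ2]] := poly_solution hg21 htheta_sq nz_theta.
have P_good R l1 l2 m1 m2 : P R -> good theta l1 l2 m1 m2 ->
    omega g12 g21 theta l1 l2 m1 m2 = omega_rhs R l1 l2 m1 m2.
  move=> PR [[? ? ? ?] [? ?] [? ?] [? ?]]; apply: PR.
  by rewrite /dom !(det_neq0 htheta_sq); do 8![apply/andP; split=> //].
have P_form R l1 l2 m1 m2 (PR : P R) (gd : good theta l1 l2 m1 m2) :=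
  let: And4 (And4 tl tm ne1 _) (conj nl1 nl2) (conj nm1 nm2) (conj nm1N nm2N) := gd in
  proj1 (omega_form1 hm htheta_sq GQ szQ1 R tl tm ne1 nl1 nl2 nm1 nm2 nm1N nm2N)
    (P_good R l1 l2 m1 m2 PR gd).
split.
  (* Existence: N1 vanishes on w1 z1 = 1, that is for lambda_1 = mu_1, and the quotient by 1 - w1 z1
     has coefficient matrix R. *)
  have [|R RE] := displacement_quotient (X := (left_mx1 Q)^T *m right_mx1 Q) nz_a.
  - apply: almost_imp (almost_vanish nz_theta) => x; apply: almost_imp => m2.
    apply: almost_imp => l2 [tl tm ne2 [nx nl2 nxN nm2N]].
    rewrite pairing1_form //; have /eqP := pairing_relation hg21 GQ tl tm.
    rewrite subrr mul0r mulf_eq0 subr_eq0 (negPf ne2) => /eqP ->.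
    by rewrite mulr0.
  exists R; split=> [l1 l2 m1 m2|R' PR'].
    rewrite /dom !(det_neq0 htheta_sq) => /and5P[ne1 nl1 nl2 nm1 /and5P[nm1N nm2 nm2N tl tm]].
    by apply/(omega_form1 hm htheta_sq GQ szQ1).
  (* Uniqueness: at good points 1 - w1 z1 is nonzero and cancels, so R and R' define the same
     form. *)
  apply/eqP; rewrite -subr_eq0; apply/eqP/(vander_form_eq0 nz_aN nz_a).
  apply: almost_imp (almost_good21 nz_theta) => m2; apply: almost_imp => m1.
  apply: almost_imp => l2; apply: almost_imp => l1 gd.
  have := P_form R' _ _ _ _ PR' gd; rewrite RE.
  have [[_ _ ne1 _] [nl1 _] _ [nm1N _]] := gd.
  have nzd : 1 - cayley (- ('i / 2%:R)) m1 * cayley ('i / 2%:R) l1 != 0.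
    rewrite cayley_mul_sub // !mulf_neq0 ?neq0Ci ?invr_neq0 ?subr_eq0 // mulf_neq0 ?subr_eq0 //.
    by rewrite -subr_eq0 opprK in nm1N.
  move/(mulfI nzd) => eqR.
  by rewrite mulmxBr mulmxBl mxE -eqR [X in _ + X]mxE subrr.
move=> R PR detR; have RT : R *m invmx R = 1%:M by rewrite mulmxV // unitmxE unitfE.
move: (invmx R) RT => T RT; apply: toeplitz_block_toeplitz_shift.
  (* Outer shift, from N1. *)
  apply: (inv_displacement_shift (Pc := left_mx1 Q) (Qc := right_mx1 Q) nz_aN nz_a RT).
  apply: almost_imp (almost_good21 nz_theta) => m2; apply: almost_imp => m1.
  by apply: almost_imp => l2; apply: almost_imp => l1; apply: P_form.
(* Inner shift, from N2 and the inverse pair with exchanged levels. *)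
apply: (inv_displacement_shift (Pc := left_mx2 Q) (Qc := right_mx2 Q) nz_aN nz_a
  (swap_blocks_mul RT)).
apply: almost_imp (almost_good12 nz_theta) => m1; apply: almost_imp => m2.
apply: almost_imp => l1; apply: almost_imp => l2 gd.
exact: (omega_form2 hn hg21 htheta_sq GQ szQ2 gd (P_good _ _ _ _ _ PR gd)).
Qed.
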